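(* Let $H=H(A)$ and $V=V(A,\varphi)$ be smooth functions on $\mathbb R\times\mathbb T$, let $\omega(A)=\partial_AH$, let $\mathcal H=1-\mathrm e^{-\{H\}}$, let $\Gamma$ be a linear pseudo-inverse of $\mathcal H$, i.e. $\mathcal H^2\Gamma=\mathcal H$, and put $\mathcal N=\mathcal H\Gamma$, $\mathcal R=1-\mathcal N$. Define the control term $$f=(\partial_AV)\,\partial_\varphi\Gamma V-\frac{\partial_A\omega}{2}\,(\partial_\varphi\Gamma V)^2+(\partial_\varphi\mathcal R V)\,\partial_A(\mathcal N V-\Gamma V).$$ Then the controlled map $(A,\varphi)\mapsto(A',\varphi')$ with generating function in mixed coordinates $$S_{\mathrm c}(A',\varphi)=A'\varphi+H(A')+\varepsilon V(A',\varphi)+\varepsilon^2f(A',\varphi)$$ is canonically conjugate to a map $(A_0,\varphi_0)\mapsto(A_0',\varphi_0')$ with generating function $$S_0(A_0',\varphi_0)=A_0'\varphi_0+H(A_0')+\varepsilon\,(\mathcal R V)(A_0',\varphi_0)+O(\varepsilon^3).$$ The conjugation is the near-identity canonical transformation with generating function $X(A_0,\varphi)=A_0\varphi+\varepsilon\chi(A_0,\varphi)$, $\chi=\mathcal N V-\Gamma V$, which maps $(A,\varphi)$ to $(A_0,\varphi_0)$ and $(A',\varphi')$ to $(A_0',\varphi_0')$ (the same $\chi$ in both cases).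
   Context: The phase space is $\mathbb R\times\mathbb T$ with coordinates $(A,\varphi)$, $\mathbb T=\mathbb R/2\pi\mathbb Z$, and $\mathcal A$ is the space of $C^\infty$ real functions on it. For $H\in\mathcal A$, $\{H\}=\frac{\partial H}{\partial A}\frac{\partial}{\partial\varphi}-\frac{\partial H}{\partial\varphi}\frac{\partial}{\partial A}$ as an operator on $\mathcal A$; for $H=H(A)$, $(\mathrm e^{\{H\}}U)(A,\varphi)=U(A,\varphi+\omega(A))$. A generating function in mixed coordinates $S(A',\varphi)=A'\varphi+\cdots$ defines the map $(A,\varphi)\mapsto(A',\varphi')$ implicitly by $A=\partial_\varphi S(A',\varphi)$ and $\varphi'=\partial_{A'}S(A',\varphi)$. For example, $S_{\mathrm c}$ gives $A=A'+\varepsilon\partial_\varphi V(A',\varphi)+\varepsilon^2\partial_\varphi f(A',\varphi)$ and $\varphi'=\varphi+\omega(A')+\varepsilon\partial_AV(A',\varphi)+\varepsilon^2\partial_Af(A',\varphi)$. The transformation generated by $X$ is given by $A=A_0+\varepsilon\partial_\varphi\chi(A_0,\varphi)$, $\varphi_0=\varphi+\varepsilon\partial_A\chi(A_0,\varphi)$, and in the same way with primes: $A'=A_0'+\varepsilon\partial_\varphi\chi(A_0',\varphi')$, $\varphi_0'=\varphi'+\varepsilon\partial_A\chi(A_0',\varphi')$. Here $\partial_A$ and $\partial_\varphi$ denote partial derivatives with respect to the first (action) and second (angle) argument. Expansions in $\varepsilon$ and the symbol $O(\varepsilon^3)$ are understood in the sense of formal power series in $\varepsilon$ (equality of the coefficients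 of $\varepsilon^0,\varepsilon^1,\varepsilon^2$). The pseudo-inverse $\Gamma:\mathcal A\to\mathcal A$ is assumed to exist. Formally, for $U=\sum_kU_k(A)\mathrm e^{ik\varphi}$ one may take $\Gamma U=\sum_{k:\,k\omega(A)\notin2\pi\mathbb Z}\frac{U_k(A)}{1-\mathrm e^{-ik\omega(A)}}\mathrm e^{ik\varphi}$, so that $\mathcal RU=\sum_{k:\,k\omega(A)\in2\pi\mathbb Z}U_k(A)\mathrm e^{ik\varphi}$ and $\mathcal NU=\sum_{k:\,k\omega(A)\notin2\pi\mathbb Z}U_k(A)\mathrm e^{ik\varphi}$. *)

(* Defs.v *)
From Stdlib Require Import Reals FinFun Factorial.
From Coquelicot Require Import Coquelicot.
Open Scope R_scope.

(** * Functions on the phase space R x T *)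

Definition dA (F : R -> R -> R) : R -> R -> R :=
  fun A phi => Derive (fun t => F t phi) A.

Definition dphi (F : R -> R -> R) : R -> R -> R :=
  fun A phi => Derive (fun t => F A t) phi.

(** C^infinity: all iterated partial derivatives exist and are continuous. *)
Definition smooth (F : R -> R -> R) : Prop :=
  forall n A phi, ex_diff_n F n A phi.

(** The space of smooth functions on R x T, T = R / 2 pi Z, as functions on
    R x R that are 2 pi-periodic in the second variable. *)
Definition calA (F : R -> R -> R) : Prop :=
  smooth F /\ forall A phi, F A (phi + 2 * PI) = F A phi.

(** * Operators attached to H = H(A) *)

Definition bracket (H U : R -> R -> R) : R -> R -> R :=
  fun A phi => dA H A phi * dphi U A phi - dphi H A phi * dA U A phi.

(** e^{H} for H = H(A): e^{tH} is composition with the time-t flow of the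
    vector field {H} = omega(A) d/dphi (see [exp_bracket_flow]).  The
    exponential series itself need not converge on smooth functions. *)
Definition exp_bracket (H : R -> R) (U : R -> R -> R) : R -> R -> R :=
  fun A phi => U A (phi + Derive H A).

Lemma exp_bracket_flow (H : R -> R) (U : R -> R -> R) (t A phi : R) :
  (forall p, ex_derive (fun q => U A q) p) ->
  is_derive (fun s => exp_bracket (fun a => s * H a) U A phi) t
    (bracket (fun a _ => H a) (exp_bracket (fun a => t * H a) U) A phi).
Proof.
intros HU.
unfold bracket, exp_bracket, dA, dphi.
rewrite Derive_const, Rmult_0_l, Rminus_0_r.
rewrite Derive_scal.
apply (is_derive_ext (fun s => U A (phi + s * Derive H A))).
{ intros s; rewrite Derive_scal; reflexivity. }
assert (E : Derive (fun q => U A (q + t * Derive H A)) phi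
            = Derive (fun q => U A q) (phi + t * Derive H A)).
{ apply is_derive_unique.
  evar_last.
  - apply (is_derive_comp (fun q => U A q) (fun q => q + t * Derive H A)).
    + apply Derive_correct, HU.
    + auto_derive; [exact I | reflexivity].
  - exact (Rmult_1_l _). }
rewrite E.
evar_last.
- apply (is_derive_comp (fun q => U A q) (fun s => phi + s * Derive H A)).
  + apply Derive_correct, HU.
  + auto_derive; [exact I | reflexivity].
- rewrite Rmult_1_l; reflexivity.
Qed.

(** 1 - e^{-{H}}, using - {H} = {- H}. *)
Definition calH (H : R -> R) (U : R -> R -> R) : R -> R -> R :=
  fun A phi => U A phi - exp_bracket (fun a => - H a) U A phi.

(** The operators on [calA] are functions on all of R -> R -> R; their values
    outside [calA] are irrelevant and left unconstrained. *)
Definition linear_on_calA (G : (R -> R -> R) -> (R -> R -> R)) : Prop :=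
  (forall U, calA U -> calA (G U)) /\
  (forall U W, calA U -> calA W -> forall A phi,
     G (fun a p => U a p + W a p) A phi = G U A phi + G W A phi) /\
  (forall c U, calA U -> forall A phi,
     G (fun a p => c * U a p) A phi = c * G U A phi).

Definition pseudo_inverse
    (H : R -> R) (Gam : (R -> R -> R) -> (R -> R -> R)) : Prop :=
  linear_on_calA Gam /\
  forall U, calA U -> forall A phi,
    calH H (calH H (Gam U)) A phi = calH H U A phi.

Definition calN (H : R -> R) (Gam : (R -> R -> R) -> (R -> R -> R))
    (U : R -> R -> R) : R -> R -> R := calH H (Gam U).

Definition calR (H : R -> R) (Gam : (R -> R -> R) -> (R -> R -> R))
    (U : R -> R -> R) : R -> R -> R :=
  fun A phi => U A phi - calN H Gam U A phi.

Definition chi (H : R -> R) (Gam : (R -> R -> R) -> (R -> R -> R))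
    (V : R -> R -> R) : R -> R -> R :=
  fun A phi => calN H Gam V A phi - Gam V A phi.

Definition control_term (H : R -> R) (Gam : (R -> R -> R) -> (R -> R -> R))
    (V : R -> R -> R) : R -> R -> R :=
  let omega := Derive H in
  fun A phi =>
    dA V A phi * dphi (Gam V) A phi
    - Derive omega A / 2 * (dphi (Gam V) A phi) ^ 2
    + dphi (calR H Gam V) A phi * dA (chi H Gam V) A phi.

(** * Formal power series in eps

    A sequence c represents sum_k c_k eps^k.  A map depending formally on eps
    is described by its action on points whose two coordinates lie in
    R[[eps]].  The angle is lifted from T to its universal cover, so that
    S(A', phi) = A' phi + ... makes sense. *)

Definition fnum : Type := nat -> R.
Definition fpoint : Type := (fnum * fnum)%type.   (* (action, angle) *)
Definition fseries : Type := nat -> R -> R -> R.  (* sum_k F_k(A, phi) eps^k *)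

Definition PS_one : fnum := fun n => match n with O => 1 | S _ => 0 end.

Fixpoint PS_pow (a : fnum) (m : nat) : fnum :=
  match m with O => PS_one | S m => PS_mult a (PS_pow a m) end.

(** a - a_0 *)
Definition tail (a : fnum) : fnum :=
  fun n => match n with O => 0 | S _ => a n end.

(** Substitution of formal points in a smooth function by Taylor expansion at
    (a_0, p_0):
      sum_{m,k} (d_A^m d_phi^k F)(a_0, p_0) / (m! k!) (a - a_0)^m (p - p_0)^k.
    The terms with m > n or k > n do not contribute to the coefficient of
    eps^n. *)
Definition feval1 (F : R -> R -> R) (a p : fnum) : fnum :=
  fun n =>
    sum_f_R0 (fun m =>
      sum_f_R0 (fun k =>
        partial_derive m k F (a 0%nat) (p 0%nat)
          / (INR (fact m) * INR (fact k))
        * PS_mult (PS_pow (tail a) m) (PS_pow (tail p) k) n) n) n.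

(** Substitution in sum_k F_k eps^k. *)
Definition feval (F : fseries) (a p : fnum) : fnum :=
  fun n => sum_f_R0 (fun k => feval1 (F k) a p (n - k)%nat) n.

Definition fdA (S : fseries) : fseries := fun k => dA (S k).
Definition fdphi (S : fseries) : fseries := fun k => dphi (S k).

(** * Maps given by a generating function in mixed coordinates *)

(** (A, phi) and (A', phi') satisfy
      A = d_phi S(A', phi),  phi' = d_{A'} S(A', phi). *)
Definition generates (S : fseries) (x x' : fpoint) : Prop :=
  let (A, phi) := x in
  let (A', phi') := x' in
  A = feval (fdphi S) A' phi /\ phi' = feval (fdA S) A' phi.

Definition full_turn (x : fpoint) : fpoint :=
  (fst x, fun n => match n with
                   | O => snd x O + 2 * PI
                   | S _ => snd x n
                   end).

(** T is the map defined implicitly by S: its graph is the relation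
    [generates S], and it descends to the cylinder R x T. *)
Definition map_generated_by (S : fseries) (T : fpoint -> fpoint) : Prop :=
  (forall x x', T x = x' <-> generates S x x') /\
  (forall x, T (full_turn x) = full_turn (T x)).

(** A phi + h(A) + eps s1(A, phi) + eps^2 s2(A, phi) *)
Definition genfun (h : R -> R) (s1 s2 : R -> R -> R) : fseries :=
  fun k A phi =>
    match k with
    | 0%nat => A * phi + h A
    | 1%nat => s1 A phi
    | 2%nat => s2 A phi
    | _ => 0
    end.

Definition S_c (H : R -> R) (Gam : (R -> R -> R) -> (R -> R -> R))
    (V : R -> R -> R) : fseries :=
  genfun H V (control_term H Gam V).

Definition X_gen (H : R -> R) (Gam : (R -> R -> R) -> (R -> R -> R))
    (V : R -> R -> R) : fseries :=
  genfun (fun _ => 0) (chi H Gam V) (fun _ _ => 0).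

(** S = S' + O(eps^3), the remainder being a formal power series with
    coefficients in [calA]. *)
Definition eq_mod_eps3 (S S' : fseries) : Prop :=
  (forall k A phi, (k < 3)%nat -> S k A phi = S' k A phi) /\
  (forall k, (3 <= k)%nat -> calA (fun A phi => S k A phi - S' k A phi)).

(* Main.v *)
Require Import Defs.
From Stdlib Require Import Reals FinFun Lra Lia Factorial FunctionalExtensionality.
From Coquelicot Require Import Coquelicot.
Open Scope R_scope.

(** The conjugated map has, to all orders in eps, the generating function
      S_0(A_0', phi_0) = S_c(A', phi) + X(A_0', phi') - A' phi' - X(A_0, phi) + A_0 phi_0,
    in which A_0, phi, A', phi' are functions of (A_0', phi_0), found by an
    eps-adic contraction, that make the right-hand side critical.  Criticality gives
    d_phi S_0 = A_0 and d_A S_0 = phi_0' at real points; these identities pass to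
    formal points because substitution of formal points is multiplicative and
    compatible with composition.  Since chi(A, phi) = - (Gamma V)(A, phi - omega(A)),
    the coefficients of S_0 of order at most 2 collapse to the asserted ones. *)

(** [generates] speaks of points with coordinates in R[[eps]], while partial derivatives are taken
    at real points. A smooth function reaches a formal point only through its Taylor coefficients,
    so sums, products and compositions must first be shown to commute with [feval]; this is the bulk
    of the work. Afterwards an equation between smooth fields on the real plane may be read at any
    formal point. Every implicit equation is put in a form where the unknowns on the right carry a
    factor eps. This gives existence and uniqueness at once, and uniqueness alone then yields
    periodicity and the identification of solutions at formal points. Criticality serves a second
    time at low order: the second-order corrections of the intermediate variables drop out of S_0 at
    order eps^2. What is left there is (omega'/2)(d_phi Gamma V)^2 - (d_A V)(d_phi Gamma V) - (d_phi
    R V)(d_A chi) + f, with omega' = d_A omega, and the control term f is precisely what makes it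
    zero. *)

(** * The ring R[[eps]] *)

Definition fconst (c : R) : fnum := fun n => match n with O => c | S _ => 0 end.
Definition fadd (a b : fnum) : fnum := fun n => a n + b n.
Definition fopp (a : fnum) : fnum := fun n => - a n.
Definition fsub (a b : fnum) : fnum := fun n => a n - b n.
Definition fmul (a b : fnum) : fnum := PS_mult a b.
Definition fshift (a : fnum) : fnum := fun n => a (S n).
Definition eps : fnum := fun n => match n with 1%nat => 1 | _ => 0 end.

(** Peeling one coefficient off a Cauchy product turns commutativity and associativity into
    inductions on the index of the coefficient, without reindexing double sums. *)
Lemma fmul_S (a b : fnum) (n : nat) :
  fmul a b (S n) = a O * b (S n) + fmul (fshift a) b n.
Proof.
unfold fmul, PS_mult. rewrite decomp_sum by lia. simpl pred.
f_equal.
Qed.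

Lemma fmul_S_r (a b : fnum) (n : nat) :
  fmul a b (S n) = a (S n) * b O + fmul a (fshift b) n.
Proof.
revert a; induction n as [|n IH]; intros a.
- unfold fmul, PS_mult; simpl; unfold fshift; ring.
- rewrite fmul_S, IH, (fmul_S a (fshift b)). unfold fshift; ring.
Qed.

Lemma fmul_comm (a b : fnum) : fmul a b = fmul b a.
Proof.
apply functional_extensionality; intros n; revert a b.
induction n as [|n IH]; intros a b.
- unfold fmul, PS_mult; simpl; ring.
- rewrite fmul_S, fmul_S_r, IH; ring.
Qed.

Lemma fmul_add_l (a b c : fnum) :
  fmul (fadd a b) c = fadd (fmul a c) (fmul b c).
Proof.
apply functional_extensionality; intros n; unfold fmul, PS_mult, fadd.
rewrite <- sum_plus. apply sum_eq; intros; ring.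
Qed.

Lemma PS_pow_S (a : fnum) (m : nat) : PS_pow a (S m) = fmul a (PS_pow a m).
Proof. reflexivity. Qed.

Lemma fconst_mul (c : R) (a : fnum) (n : nat) :
  fmul (fconst c) a n = c * a n.
Proof.
unfold fmul, PS_mult. destruct n as [|n]; [reflexivity|].
rewrite decomp_sum by lia. simpl.
rewrite (sum_eq _ (fun _ => 0)) by (intros; ring).
rewrite sum_cte; ring.
Qed.

Lemma fmul_assoc (a b c : fnum) :
  fmul a (fmul b c) = fmul (fmul a b) c.
Proof.
apply functional_extensionality; intros n; revert a b c.
induction n as [|n IH]; intros a b c.
- unfold fmul, PS_mult; simpl; ring.
- rewrite !fmul_S.
  replace (fshift (fmul a b))
    with (fadd (fmul (fconst (a O)) (fshift b)) (fmul (fshift a) b)).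
  + rewrite fmul_add_l. unfold fadd. rewrite <- !IH, fconst_mul.
    replace (fmul a b 0%nat) with (a O * b O) by reflexivity. ring.
  + apply functional_extensionality; intros k; unfold fshift at 3.
    rewrite fmul_S; unfold fadd; rewrite fconst_mul; reflexivity.
Qed.

Lemma fnum_ring : ring_theory (fconst 0) PS_one fadd fmul fsub fopp eq.
Proof.
constructor; intros;
  try (apply functional_extensionality; intros n).
- unfold fadd; destruct n; simpl; ring.
- unfold fadd; ring.
- unfold fadd; ring.
- change PS_one with (fconst 1); rewrite fconst_mul; ring.
- rewrite fmul_comm; reflexivity.
- rewrite fmul_assoc; reflexivity.
- rewrite fmul_add_l; reflexivity.
- unfold fadd, fopp, fsub; ring.
- unfold fadd, fopp; destruct n; simpl; ring.
Qed.

Add Ring fnum_ring : fnum_ring.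

Declare Scope fnum_scope.
Delimit Scope fnum_scope with fnum.
Bind Scope fnum_scope with fnum.
Notation "a + b" := (fadd a b) : fnum_scope.
Notation "a - b" := (fsub a b) : fnum_scope.
Notation "- a" := (fopp a) : fnum_scope.
Notation "a * b" := (fmul a b) : fnum_scope.

Lemma eps_mul_0 (a : fnum) : fmul eps a O = 0.
Proof. unfold fmul, PS_mult; simpl; ring. Qed.

Lemma eps_mul_S (a : fnum) (n : nat) : fmul eps a (S n) = a n.
Proof.
rewrite fmul_S.
replace (fshift eps) with (fconst 1).
- rewrite fconst_mul; simpl; ring.
- apply functional_extensionality; intros [|k]; reflexivity.
Qed.

Lemma fconst_0_mul (a : fnum) : (fconst 0 * a)%fnum = fconst 0.
Proof. ring. Qed.

Lemma tail_fsub (a : fnum) : tail a = (a - fconst (a O))%fnum.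
Proof.
apply functional_extensionality; intros [|n]; unfold tail, fsub; simpl; ring.
Qed.

Lemma fconst_add (c d : R) : fconst (c + d) = (fconst c + fconst d)%fnum.
Proof.
apply functional_extensionality; intros [|n]; unfold fadd; simpl; ring.
Qed.

Lemma fconst_fmul (c d : R) : fconst (c * d) = (fconst c * fconst d)%fnum.
Proof.
apply functional_extensionality; intros n; rewrite fconst_mul.
destruct n; simpl; ring.
Qed.

(** The ideal generated by eps^n. *)
Definition vanish (n : nat) (a : fnum) : Prop := forall k, (k < n)%nat -> a k = 0.

Lemma vanish_add (n : nat) (a b : fnum) :
  vanish n a -> vanish n b -> vanish n (a + b)%fnum.
Proof. intros Ha Hb k Hk; unfold fadd; rewrite Ha, Hb by assumption; ring. Qed.

Lemma vanish_mul (m n : nat) (a b : fnum) :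
  vanish m a -> vanish n b -> vanish (m + n) (a * b)%fnum.
Proof.
revert a; induction m as [|m IH]; intros a Ha Hb k Hk.
- unfold fmul, PS_mult. rewrite (sum_eq _ (fun _ => 0)).
  + rewrite sum_cte; ring.
  + intros i Hi; rewrite Hb by (simpl in Hk; lia); ring.
- destruct k as [|k].
  + unfold fmul, PS_mult; simpl; rewrite Ha by lia; ring.
  + rewrite fmul_S, Ha by lia.
    rewrite (IH (fshift a)); [ring | | exact Hb | lia].
    intros j Hj; apply Ha; lia.
Qed.

Lemma vanish_pow (a : fnum) (m : nat) : a O = 0 -> vanish m (PS_pow a m).
Proof.
intros Ha; induction m as [|m IH].
- intros k Hk; lia.
- rewrite PS_pow_S; apply (vanish_mul 1 m); [|exact IH].
  intros k Hk; replace k with O by lia; exact Ha.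
Qed.

(** * Differentiation of one-parameter families *)

(** Coefficientwise differentiation suffices: each coefficient of a sum, product or substitution
    involves finitely many coefficients of the arguments. *)
Definition fder (z : R -> fnum) (t : R) (z' : fnum) : Prop :=
  forall n, is_derive (fun s => z s n) t (z' n).

Lemma fder_add (y z : R -> fnum) (t : R) (y' z' : fnum) :
  fder y t y' -> fder z t z' -> fder (fun s => y s + z s)%fnum t (y' + z')%fnum.
Proof. intros Hy Hz n; exact (is_derive_plus _ _ _ _ _ (Hy n) (Hz n)). Qed.

Lemma fder_sub (y z : R -> fnum) (t : R) (y' z' : fnum) :
  fder y t y' -> fder z t z' -> fder (fun s => y s - z s)%fnum t (y' - z')%fnum.
Proof. intros Hy Hz n; exact (is_derive_minus _ _ _ _ _ (Hy n) (Hz n)). Qed.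

Lemma fder_cst (c : fnum) (t : R) : fder (fun _ => c) t (fconst 0).
Proof.
intros n; replace (fconst 0 n) with 0 by (destruct n; reflexivity).
exact (is_derive_const (c n) t).
Qed.

Lemma is_derive_sum_f_R0 (f : nat -> R -> R) (d : nat -> R) (n : nat) (t : R) :
  (forall k, (k <= n)%nat -> is_derive (f k) t (d k)) ->
  is_derive (fun s => sum_f_R0 (fun k => f k s) n) t (sum_f_R0 d n).
Proof.
intros H; induction n as [|n IH]; simpl.
- apply H; lia.
- apply (is_derive_plus (fun s => sum_f_R0 (fun k => f k s) n) (f (S n))).
  + apply IH; intros; apply H; lia.
  + apply H; lia.
Qed.

Lemma is_derive_mult_R (f g : R -> R) (t f' g' : R) :
  is_derive f t f' -> is_derive g t g' ->
  is_derive (fun s => f s * g s) t (f' * g t + f t * g').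
Proof.
intros Hf Hg; exact (is_derive_mult f g t f' g' Hf Hg Rmult_comm).
Qed.

Lemma fder_mul (y z : R -> fnum) (t : R) (y' z' : fnum) :
  fder y t y' -> fder z t z' ->
  fder (fun s => y s * z s)%fnum t (y' * z t + y t * z')%fnum.
Proof.
intros Hy Hz n; unfold fmul, PS_mult, fadd.
rewrite <- sum_plus.
apply (is_derive_sum_f_R0 (fun k s => y s k * z s (n - k)%nat)
         (fun k => y' k * z t (n - k)%nat + y t k * z' (n - k)%nat)).
intros k _; apply is_derive_mult_R; [apply Hy | apply Hz].
Qed.

Lemma fder_eq (y z : R -> fnum) (t : R) (y' z' : fnum) :
  fder y t y' -> (forall s, y s = z s) -> y' = z' -> fder z t z'.
Proof.
intros Hy E <- n; apply (is_derive_ext (fun s => y s n)); [|apply Hy].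
intros s; rewrite E; reflexivity.
Qed.

Lemma fder_pow (z : R -> fnum) (t : R) (z' : fnum) (m : nat) :
  fder z t z' ->
  fder (fun s => PS_pow (z s) m) t
    (fconst (INR m) * (PS_pow (z t) (pred m) * z'))%fnum.
Proof.
intros Hz; induction m as [|m IH].
- apply (fder_eq (fun _ => PS_one) _ _ _ _ (fder_cst _ _)); [reflexivity|].
  rewrite fconst_0_mul; reflexivity.
- apply (fder_eq _ _ _ _ _ (fder_mul _ _ _ _ _ Hz IH)); [reflexivity|].
  rewrite S_INR, fconst_add; change (fconst 1) with PS_one.
  destruct m; simpl pred.
  + change (PS_pow (z t) 0) with PS_one; change (INR 0) with 0; ring.
  + rewrite PS_pow_S; ring.
Qed.

Lemma fder_fconst (f : R -> R) (t f' : R) :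
  is_derive f t f' -> fder (fun s => fconst (f s)) t (fconst f').
Proof.
intros H [|n]; simpl; [exact H|]. exact (is_derive_const 0 t).
Qed.

Lemma fder_tail (z : R -> fnum) (t : R) (z' : fnum) :
  fder z t z' -> fder (fun s => tail (z s)) t (tail z').
Proof.
intros H [|n]; simpl; [exact (is_derive_const 0 t) | apply H].
Qed.

Lemma fder_zero_const (z : R -> fnum) (n : nat) :
  (forall t, is_derive (fun s => z s n) t 0) -> forall t, z t n = z 0 n.
Proof.
intros H t.
destruct (Rle_lt_dec 0 t) as [Ht|Ht].
- destruct (Req_dec 0 t) as [<-|Hn]; [reflexivity|].
  symmetry; apply (eq_is_derive (fun s => z s n) 0 t); [intros; apply H | lra].
- apply (eq_is_derive (fun s => z s n) t 0); [intros; apply H | lra].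
Qed.

(** * Smooth functions of two variables *)

(** Finite order is what permits induction: closure under products and composition at order [S N]
    uses closure at order [N] for the derivatives. *)
Definition Ck (N : nat) (F : R -> R -> R) : Prop := forall x y, ex_diff_n F N x y.

Lemma Ck_S (N : nat) (F : R -> R -> R) :
  Ck (S N) F <->
  (forall x y, continuity_2d_pt F x y) /\
  (forall x y, ex_derive (fun z => F z y) x) /\
  (forall x y, ex_derive (fun z => F x z) y) /\ Ck N (dA F) /\ Ck N (dphi F).
Proof.
split.
- intros H; repeat split; try intros x y; try apply (H x y); intros x y; apply (H x y).
- intros (H1 & H2 & H3 & H4 & H5) x y.
  exact (conj (H1 x y) (conj (H2 x y) (conj (H3 x y) (conj (H4 x y) (H5 x y))))).
Qed.

Lemma Ck_0 (F : R -> R -> R) : Ck 0 F <-> forall x y, continuity_2d_pt F x y.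
Proof. split; intros H x y; [apply H | split; auto]. Qed.

Lemma Ck_le (N M : nat) (F : R -> R -> R) : (M <= N)%nat -> Ck N F -> Ck M F.
Proof. intros H HF x y; apply (ex_diff_n_m N M H), HF. Qed.

Lemma Ck_cont (N : nat) (F : R -> R -> R) (x y : R) :
  Ck N F -> continuity_2d_pt F x y.
Proof. intros H; destruct N; apply (H x y). Qed.

Lemma smooth_Ck (F : R -> R -> R) : smooth F <-> forall N, Ck N F.
Proof. split; intros H n x y; apply H. Qed.

Lemma smooth_dA (F : R -> R -> R) : smooth F -> smooth (dA F).
Proof.
intros H; apply smooth_Ck; intros N.
apply (proj1 (Ck_S N F) (proj1 (smooth_Ck F) H (S N))).
Qed.

Lemma smooth_dphi (F : R -> R -> R) : smooth F -> smooth (dphi F).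
Proof.
intros H; apply smooth_Ck; intros N.
apply (proj1 (Ck_S N F) (proj1 (smooth_Ck F) H (S N))).
Qed.

Lemma smooth_is_dA (F : R -> R -> R) (x y : R) :
  smooth F -> is_derive (fun t => F t y) x (dA F x y).
Proof. intros H; apply Derive_correct; apply (H 1%nat x y). Qed.

Lemma smooth_is_dphi (F : R -> R -> R) (x y : R) :
  smooth F -> is_derive (fun t => F x t) y (dphi F x y).
Proof. intros H; apply Derive_correct; apply (H 1%nat x y). Qed.

Lemma fun2_ext (F G : R -> R -> R) : (forall x y, F x y = G x y) -> F = G.
Proof.
intros H; apply functional_extensionality; intros x;
apply functional_extensionality; intros y; apply H.
Qed.

Lemma dA_unique (F G : R -> R -> R) :
  (forall x y, is_derive (fun t => F t y) x (G x y)) -> dA F = G.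
Proof. intros H; apply fun2_ext; intros x y; apply is_derive_unique, H. Qed.

Lemma dphi_unique (F G : R -> R -> R) :
  (forall x y, is_derive (fun t => F x t) y (G x y)) -> dphi F = G.
Proof. intros H; apply fun2_ext; intros x y; apply is_derive_unique, H. Qed.

Lemma Ck_is_derive (N : nat) (F : R -> R -> R) (a p : R -> R) (t a' p' : R) :
  Ck (S N) F -> is_derive a t a' -> is_derive p t p' ->
  is_derive (fun s => F (a s) (p s)) t
    (dA F (a t) (p t) * a' + dphi F (a t) (p t) * p').
Proof.
intros HF Ha Hp.
apply Ck_S in HF; destruct HF as (H1 & H2 & H3 & H4 & H5).
apply is_derive_Reals.
apply derivable_pt_lim_comp_2d; [|apply is_derive_Reals; assumption..].
apply filterdiff_differentiable_pt_lim.
(* Differentiability at a point follows from one partial derivative that exists nearby and is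
   continuous there, together with the other at the point alone. *)
apply (is_derive_filterdiff F (a t) (p t) (dA F) (dphi F (a t) (p t))).
- apply filter_forall; intros u; apply Derive_correct, H2.
- apply Derive_correct, H3.
- apply continuity_2d_pt_filterlim, (Ck_cont N), H4.
Qed.

Lemma continuity_2d_pt_comp2 (F a p : R -> R -> R) (x y : R) :
  continuity_2d_pt F (a x y) (p x y) ->
  continuity_2d_pt a x y -> continuity_2d_pt p x y ->
  continuity_2d_pt (fun u v => F (a u v) (p u v)) x y.
Proof.
intros HF Ha Hp e.
destruct (HF e) as [d Hd].
generalize (locally_2d_and _ _ _ _ (Ha d) (Hp d)).
apply locally_2d_impl, locally_2d_forall; intros u v [H1 H2].
apply Hd; assumption.
Qed.

Lemma Ck_const (N : nat) (c : R) : Ck N (fun _ _ => c).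
Proof.
revert c; induction N as [|N IH]; intros c.
- apply Ck_0; intros; apply continuity_2d_pt_const.
- apply Ck_S; repeat split.
  + intros; apply continuity_2d_pt_const.
  + intros; apply ex_derive_const.
  + intros; apply ex_derive_const.
  + rewrite (dA_unique _ (fun _ _ => 0)) by (intros; exact (is_derive_const c x)).
    apply IH.
  + rewrite (dphi_unique _ (fun _ _ => 0)) by (intros; exact (is_derive_const c y)).
    apply IH.
Qed.

Lemma smooth_const (c : R) : smooth (fun _ _ => c).
Proof. apply smooth_Ck; intros N; apply Ck_const. Qed.

Lemma smooth_fst : smooth (fun x _ => x).
Proof.
apply smooth_Ck; intros [|N].
- apply Ck_0; intros; apply continuity_2d_pt_id1.
- apply Ck_S; repeat split.
  + intros; apply continuity_2d_pt_id1.
  + intros; apply ex_derive_id.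
  + intros; apply ex_derive_const.
  + rewrite (dA_unique _ (fun _ _ => 1)) by (intros; exact (is_derive_id x)).
    apply Ck_const.
  + rewrite (dphi_unique _ (fun _ _ => 0)) by (intros; exact (is_derive_const x y)).
    apply Ck_const.
Qed.

Lemma smooth_snd : smooth (fun _ y => y).
Proof.
apply smooth_Ck; intros [|N].
- apply Ck_0; intros; apply continuity_2d_pt_id2.
- apply Ck_S; repeat split.
  + intros; apply continuity_2d_pt_id2.
  + intros; apply ex_derive_const.
  + intros; apply ex_derive_id.
  + rewrite (dA_unique _ (fun _ _ => 0)) by (intros; exact (is_derive_const y x)).
    apply Ck_const.
  + rewrite (dphi_unique _ (fun _ _ => 1)) by (intros; exact (is_derive_id y)).
    apply Ck_const.
Qed.

Lemma Ck_is_dA (N : nat) (F : R -> R -> R) (x y : R) :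
  Ck (S N) F -> is_derive (fun t => F t y) x (dA F x y).
Proof. intros H; apply Derive_correct; apply (H x y). Qed.

Lemma Ck_is_dphi (N : nat) (F : R -> R -> R) (x y : R) :
  Ck (S N) F -> is_derive (fun t => F x t) y (dphi F x y).
Proof. intros H; apply Derive_correct; apply (H x y). Qed.

Lemma Ck_add (N : nat) (F G : R -> R -> R) :
  Ck N F -> Ck N G -> Ck N (fun x y => F x y + G x y).
Proof.
revert F G; induction N as [|N IH]; intros F G HF HG.
- apply Ck_0; intros; apply continuity_2d_pt_plus; eapply Ck_cont; eassumption.
- apply Ck_S; repeat split.
  + intros; apply continuity_2d_pt_plus; eapply Ck_cont; eassumption.
  + intros; eexists; apply (is_derive_plus (fun t => F t y) (fun t => G t y));
      eapply Ck_is_dA; eassumption.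
  + intros; eexists; apply (is_derive_plus (fun t => F x t) (fun t => G x t));
      eapply Ck_is_dphi; eassumption.
  + rewrite (dA_unique _ (fun x y => dA F x y + dA G x y)).
    * apply IH; [apply (proj1 (Ck_S N F) HF) | apply (proj1 (Ck_S N G) HG)].
    * intros; apply (is_derive_plus (fun t => F t y) (fun t => G t y));
        eapply Ck_is_dA; eassumption.
  + rewrite (dphi_unique _ (fun x y => dphi F x y + dphi G x y)).
    * apply IH; [apply (proj1 (Ck_S N F) HF) | apply (proj1 (Ck_S N G) HG)].
    * intros; apply (is_derive_plus (fun t => F x t) (fun t => G x t));
        eapply Ck_is_dphi; eassumption.
Qed.

Lemma Ck_mul (N : nat) (F G : R -> R -> R) :
  Ck N F -> Ck N G -> Ck N (fun x y => F x y * G x y).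
Proof.
revert F G; induction N as [|N IH]; intros F G HF HG.
- apply Ck_0; intros; apply continuity_2d_pt_mult; eapply Ck_cont; eassumption.
- assert (HF' := Ck_le (S N) N F (le_S _ _ (le_n N)) HF).
  assert (HG' := Ck_le (S N) N G (le_S _ _ (le_n N)) HG).
  assert (DA : forall x y, is_derive (fun t : R => F t y * G t y) x
            (dA F x y * G x y + F x y * dA G x y)).
  { intros; apply (is_derive_mult_R (fun t => F t y) (fun t => G t y));
      eapply Ck_is_dA; eassumption. }
  assert (DP : forall x y, is_derive (fun t : R => F x t * G x t) y
            (dphi F x y * G x y + F x y * dphi G x y)).
  { intros; apply (is_derive_mult_R (fun t => F x t) (fun t => G x t));
      eapply Ck_is_dphi; eassumption. }
  apply Ck_S; repeat split.
  + intros; apply continuity_2d_pt_mult; eapply Ck_cont; eassumption.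
  + intros; eexists; apply DA.
  + intros; eexists; apply DP.
  + rewrite (dA_unique _ _ DA).
    apply Ck_add; apply IH; auto;
      [apply (proj1 (Ck_S N F) HF) | apply (proj1 (Ck_S N G) HG)].
  + rewrite (dphi_unique _ _ DP).
    apply Ck_add; apply IH; auto;
      [apply (proj1 (Ck_S N F) HF) | apply (proj1 (Ck_S N G) HG)].
Qed.

Lemma Ck_comp (N : nat) (F a p : R -> R -> R) :
  Ck N F -> Ck N a -> Ck N p -> Ck N (fun x y => F (a x y) (p x y)).
Proof.
revert F a p; induction N as [|N IH]; intros F a p HF Ha Hp.
- apply Ck_0; intros; apply continuity_2d_pt_comp2; eapply Ck_cont; eassumption.
- assert (Ha' := Ck_le (S N) N a (le_S _ _ (le_n N)) Ha).
  assert (Hp' := Ck_le (S N) N p (le_S _ _ (le_n N)) Hp).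
  assert (DA : forall x y, is_derive (fun t : R => F (a t y) (p t y)) x
            (dA F (a x y) (p x y) * dA a x y + dphi F (a x y) (p x y) * dA p x y)).
  { intros; apply (Ck_is_derive N F (fun t => a t y) (fun t => p t y)); auto;
      eapply Ck_is_dA; eassumption. }
  assert (DP : forall x y, is_derive (fun t : R => F (a x t) (p x t)) y
            (dA F (a x y) (p x y) * dphi a x y + dphi F (a x y) (p x y) * dphi p x y)).
  { intros; apply (Ck_is_derive N F (fun t => a x t) (fun t => p x t)); auto;
      eapply Ck_is_dphi; eassumption. }
  apply Ck_S in Ha; apply Ck_S in Hp; apply Ck_S in HF.
  apply Ck_S; repeat split.
  + intros; apply continuity_2d_pt_comp2; [apply HF | apply Ha | apply Hp].
  + intros; eexists; apply DA.
  + intros; eexists; apply DP.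
  + rewrite (dA_unique _ _ DA).
    apply Ck_add; (apply Ck_mul; [apply IH|]); auto; tauto.
  + rewrite (dphi_unique _ _ DP).
    apply Ck_add; (apply Ck_mul; [apply IH|]); auto; tauto.
Qed.

Lemma smooth_add (F G : R -> R -> R) :
  smooth F -> smooth G -> smooth (fun x y => F x y + G x y).
Proof. rewrite !smooth_Ck; intros HF HG N; apply Ck_add; auto. Qed.

Lemma smooth_mul (F G : R -> R -> R) :
  smooth F -> smooth G -> smooth (fun x y => F x y * G x y).
Proof. rewrite !smooth_Ck; intros HF HG N; apply Ck_mul; auto. Qed.

Lemma smooth_comp (F a p : R -> R -> R) :
  smooth F -> smooth a -> smooth p -> smooth (fun x y => F (a x y) (p x y)).
Proof. rewrite !smooth_Ck; intros HF Ha Hp N; apply Ck_comp; auto. Qed.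

Lemma smooth_ext (F G : R -> R -> R) :
  smooth F -> (forall x y, F x y = G x y) -> smooth G.
Proof. intros H E; rewrite <- (fun2_ext F G E); exact H. Qed.

Lemma smooth_sub (F G : R -> R -> R) :
  smooth F -> smooth G -> smooth (fun x y => F x y - G x y).
Proof.
intros HF HG.
apply (smooth_ext (fun x y => F x y + (-1) * G x y)); [|intros; ring].
apply smooth_add; [|apply smooth_mul; [apply smooth_const|]]; assumption.
Qed.

Lemma smooth_sum (f : nat -> R -> R -> R) (n : nat) :
  (forall k, smooth (f k)) -> smooth (fun x y => sum_f_R0 (fun k => f k x y) n).
Proof.
intros H; induction n as [|n IH]; simpl; [apply H|].
apply smooth_add; [exact IH | apply H].
Qed.

Lemma smooth_1d (h : R -> R) :
  (forall n x, ex_derive_n h n x) -> smooth (fun x _ => h x).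
Proof.
intros H; apply smooth_Ck; intros N; revert h H.
induction N as [|N IH]; intros h H.
- apply Ck_0; intros.
  apply (continuity_1d_2d_pt_comp h (fun u _ => u));
    [|apply continuity_2d_pt_id1].
  apply continuity_pt_filterlim, (ex_derive_continuous h x), (H 1%nat).
- apply Ck_S; repeat split.
  + intros; apply (continuity_1d_2d_pt_comp h (fun u _ => u));
      [|apply continuity_2d_pt_id1].
    apply continuity_pt_filterlim, (ex_derive_continuous h x), (H 1%nat).
  + intros; apply (H 1%nat).
  + intros; apply ex_derive_const.
  + apply (IH (Derive h)); intros [|n] x; [exact I|].
    specialize (H (S (S n)) x); simpl in H.
    apply (ex_derive_ext (Derive_n h (S n))); [|exact H].
    intros t; rewrite <- (Nat.add_1_r n), <- Derive_n_comp; reflexivity.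
  + rewrite (dphi_unique _ (fun _ _ => 0)) by (intros; exact (is_derive_const (h x) y)).
    apply Ck_const.
Qed.

Lemma smooth_pd (m k : nat) (F : R -> R -> R) :
  smooth F -> smooth (partial_derive m k F).
Proof.
intros H N x y.
replace N with ((N + (m + k)) - (m + k))%nat by lia.
apply ex_diff_n_deriv; [lia | apply H].
Qed.

(** [partial_derive m k] applies the angle derivatives first and the action derivatives last. A
    further angle derivative must cross the [m] action derivatives, which is the symmetry of mixed
    partials; a further action derivative is definitional. *)
Lemma dphi_pd (m k : nat) (F : R -> R -> R) :
  smooth F -> dphi (partial_derive m k F) = partial_derive m (S k) F.
Proof.
intros H; apply fun2_ext; intros x y; apply Derive_partial_derive.
apply locally_2d_forall; intros; apply H.
Qed.

Lemma pd_dphi (m k : nat) (F : R -> R -> R) :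
  partial_derive m k (dphi F) = partial_derive m (S k) F.
Proof.
apply fun2_ext; intros x y; unfold partial_derive, dphi.
apply Derive_n_ext; intros t.
rewrite <- (Nat.add_1_r k), <- Derive_n_comp; reflexivity.
Qed.

(** The extra action derivative is innermost here; induction on [k] strips the angle derivatives
    from the outside by [dphi_pd]. *)
Lemma pd_dA (m k : nat) (F : R -> R -> R) :
  smooth F -> partial_derive m k (dA F) = partial_derive (S m) k F.
Proof.
intros H; induction k as [|k IH].
- apply fun2_ext; intros x y; unfold partial_derive, dA; simpl Derive_n at 2 4.
  rewrite <- (Nat.add_1_r m), <- Derive_n_comp; reflexivity.
- rewrite <- !dphi_pd, IH by (try apply smooth_dA; exact H); reflexivity.
Qed.

(** * Substitution of formal points *)

Definition taylor_term (F : R -> R -> R) (a p : fnum) (m k : nat) : fnum :=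
  (fconst (partial_derive m k F (a O) (p O) / (INR (fact m) * INR (fact k)))
   * (PS_pow (tail a) m * PS_pow (tail p) k))%fnum.

Definition fsum (f : nat -> fnum) (N : nat) : fnum :=
  fun n => sum_f_R0 (fun m => f m n) N.

(** In [feval1] the truncation order is the index of the coefficient. With [N] fixed, the truncation
    is a finite sum in the ring R[[eps]], to which ring identities apply. *)
Definition taylor (N : nat) (F : R -> R -> R) (a p : fnum) : fnum :=
  fsum (fun m => fsum (fun k => taylor_term F a p m k) N) N.

Lemma sum_f_R0_trunc (f : nat -> R) (n N : nat) :
  (n <= N)%nat -> (forall k, (n < k)%nat -> f k = 0) -> sum_f_R0 f N = sum_f_R0 f n.
Proof.
intros H Hf; induction H as [|N H IH]; [reflexivity|].
simpl; rewrite IH, Hf by lia; ring.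
Qed.

Lemma sum_f_R0_zero (f : nat -> R) (n : nat) :
  (forall k, (k <= n)%nat -> f k = 0) -> sum_f_R0 f n = 0.
Proof.
intros H; rewrite (sum_eq _ (fun _ => 0)) by auto; rewrite sum_cte; ring.
Qed.

Lemma sum_f_R0_pred (B : nat -> R) (n : nat) :
  sum_f_R0 (fun m => match m with O => 0 | S m' => B m' end) n + B n
  = sum_f_R0 B n.
Proof.
induction n as [|n IH]; simpl; [ring|]. rewrite IH; reflexivity.
Qed.

Lemma vanish_pow_pow (a p : fnum) (m k : nat) :
  vanish (m + k) (PS_pow (tail a) m * PS_pow (tail p) k)%fnum.
Proof. apply vanish_mul; apply vanish_pow; reflexivity. Qed.

Lemma taylor_term_vanish (F : R -> R -> R) (a p : fnum) (m k : nat) :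
  vanish (m + k) (taylor_term F a p m k).
Proof.
intros j Hj; unfold taylor_term; rewrite fconst_mul, vanish_pow_pow by exact Hj.
ring.
Qed.

Lemma feval1_taylor (F : R -> R -> R) (a p : fnum) (n N : nat) :
  (n <= N)%nat -> feval1 F a p n = taylor N F a p n.
Proof.
intros H; unfold taylor, fsum, feval1; symmetry.
rewrite (sum_f_R0_trunc _ n N H).
- apply sum_eq; intros m _.
  rewrite (sum_f_R0_trunc _ n N H).
  + apply sum_eq; intros k _; unfold taylor_term; rewrite fconst_mul; reflexivity.
  + intros k Hk; apply taylor_term_vanish; lia.
- intros m Hm; apply sum_f_R0_zero; intros k _; apply taylor_term_vanish; lia.
Qed.

Lemma fmul_agree_l (a b c : fnum) (n : nat) :
  (forall k, (k <= n)%nat -> a k = b k) -> (a * c)%fnum n = (b * c)%fnum n.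
Proof. intros H; apply sum_eq; intros k Hk; rewrite H by exact Hk; reflexivity. Qed.

Lemma fsum_mul (f : nat -> fnum) (N : nat) (c : fnum) :
  (fsum f N * c)%fnum = fsum (fun m => f m * c)%fnum N.
Proof.
induction N as [|N IH].
- reflexivity.
- change (fsum f (S N)) with (fsum f N + f (S N))%fnum.
  rewrite fmul_add_l, IH; reflexivity.
Qed.

Lemma feval1_mul_taylor (F : R -> R -> R) (a p c : fnum) (n : nat) :
  (feval1 F a p * c)%fnum n
  = sum_f_R0 (fun m => sum_f_R0 (fun k => (taylor_term F a p m k * c)%fnum n) n) n.
Proof.
rewrite (fmul_agree_l _ (taylor n F a p)) by (intros; apply feval1_taylor; assumption).
unfold taylor; rewrite fsum_mul; unfold fsum at 1; apply sum_eq; intros m _.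
rewrite fsum_mul; reflexivity.
Qed.

Lemma fconst_tail (a : fnum) : a = (fconst (a O) + tail a)%fnum.
Proof. rewrite tail_fsub; ring. Qed.

Lemma fact_S_INR (m : nat) : INR (fact (S m)) = INR (S m) * INR (fact m).
Proof. rewrite <- mult_INR; reflexivity. Qed.

(** Two things vary: the base point, which contributes only [a' O] and [p' O], and the powers of the
    tails, which contribute only [tail a'] and [tail p']. *)
Lemma fder_taylor_term (F : R -> R -> R) (a p : R -> fnum) (t : R) (a' p' : fnum)
  (m k : nat) :
  smooth F -> fder a t a' -> fder p t p' ->
  fder (fun s => taylor_term F (a s) (p s) m k) t
    (fconst ((partial_derive (S m) k F (a t O) (p t O) * a' O
             + partial_derive m (S k) F (a t O) (p t O) * p' O)
            / (INR (fact m) * INR (fact k)))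
       * (PS_pow (tail (a t)) m * PS_pow (tail (p t)) k)
     + fconst (partial_derive m k F (a t O) (p t O) / (INR (fact m) * INR (fact k)))
       * (fconst (INR m) * (PS_pow (tail (a t)) (pred m) * tail a')
            * PS_pow (tail (p t)) k
          + PS_pow (tail (a t)) m
            * (fconst (INR k) * (PS_pow (tail (p t)) (pred k) * tail p'))))%fnum.
Proof.
intros HF Ha Hp; unfold taylor_term.
apply (fder_mul
  (fun s => fconst (partial_derive m k F (a s O) (p s O) / (INR (fact m) * INR (fact k))))
  (fun s => PS_pow (tail (a s)) m * PS_pow (tail (p s)) k)%fnum).
- apply (fder_fconst (fun s =>
    partial_derive m k F (a s O) (p s O) / (INR (fact m) * INR (fact k)))); unfold Rdiv.
  evar_last.
  + apply is_derive_mult_R.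
    * apply (Ck_is_derive 0 (partial_derive m k F) (fun s => a s O) (fun s => p s O));
        [|apply Ha | apply Hp].
      apply (proj1 (smooth_Ck _) (smooth_pd m k F HF)).
    * apply (is_derive_const (/ (INR (fact m) * INR (fact k)))).
  + rewrite dphi_pd by exact HF.
    change (dA (partial_derive m k F)) with (partial_derive (S m) k F).
    change (@zero R_NormedModule) with 0. ring.
- apply (fder_mul (fun s => PS_pow (tail (a s)) m) (fun s => PS_pow (tail (p s)) k));
    apply (fder_pow (fun s => tail _)); apply fder_tail; assumption.
Qed.

(** Split [a'] into constant term and tail. Moving the base point gives the Taylor series of [dA F]
    times [a' O]; differentiating the powers gives the same series, its index shifted by one, times
    [tail a']. The two add up to the chain rule, and likewise in the angle. *)
Lemma feval1_fder (F : R -> R -> R) (a p : R -> fnum) (t : R) (a' p' : fnum) :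
  smooth F -> fder a t a' -> fder p t p' ->
  fder (fun s => feval1 F (a s) (p s)) t
    (feval1 (dA F) (a t) (p t) * a' + feval1 (dphi F) (a t) (p t) * p')%fnum.
Proof.
intros HF Ha Hp n.
apply (is_derive_ext (fun s => taylor n F (a s) (p s) n)).
{ intros s; symmetry; apply feval1_taylor; lia. }
unfold fadd; rewrite !feval1_mul_taylor.
set (tau := tail (a t)); set (sig := tail (p t)).
set (c := fun m k => partial_derive m k F (a t O) (p t O)).
(* [BA] and [BP] come from the powers of the tails, numbered by the exponent left after
   differentiation; [A0] and [P0] come from the base point. *)
set (BA := fun m => sum_f_R0 (fun k =>
  c (S m) k / (INR (fact m) * INR (fact k))
  * (PS_pow tau m * PS_pow sig k * tail a')%fnum n) n).
set (BP := fun m k =>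
  c m (S k) / (INR (fact m) * INR (fact k))
  * (PS_pow tau m * PS_pow sig k * tail p')%fnum n).
set (A0 := fun m k => c (S m) k / (INR (fact m) * INR (fact k)) * a' O
  * (PS_pow tau m * PS_pow sig k)%fnum n).
set (P0 := fun m k => c m (S k) / (INR (fact m) * INR (fact k)) * p' O
  * (PS_pow tau m * PS_pow sig k)%fnum n).
assert (Fm : forall m, INR (fact m) <> 0) by (intros; apply INR_fact_neq_0).
(* The shift of index loses the last term of each sum. That term is divisible by eps^(n+1), the
   extra factor being the tail, so coefficient [n] does not see it. *)
assert (HA : BA n = 0).
{ apply sum_f_R0_zero; intros k _.
  rewrite (vanish_mul (n + k) 1); [ring | | | lia].
  - apply vanish_pow_pow.
  - intros j Hj; replace j with O by lia; reflexivity. }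
assert (HP : forall m, BP m n = 0).
{ intros m; unfold BP.
  rewrite (vanish_mul (m + n) 1); [ring | | | lia].
  - apply vanish_pow_pow.
  - intros j Hj; replace j with O by lia; reflexivity. }
evar_last.
- apply (is_derive_sum_f_R0
    (fun m s => sum_f_R0 (fun k => taylor_term F (a s) (p s) m k n) n)).
  intros m _.
  apply (is_derive_sum_f_R0 (fun k s => taylor_term F (a s) (p s) m k n)).
  intros k _; apply (fder_taylor_term F a p t a' p' m k HF Ha Hp).
- cbv beta; fold tau sig.
  transitivity (sum_f_R0 (fun m => sum_f_R0 (fun k => A0 m k + P0 m k) n
     + match m with O => 0 | S m' => BA m' end
     + sum_f_R0 (fun k => match k with O => 0 | S k' => BP m k' end) n) n).
  + apply sum_eq; intros m _.
    transitivity (sum_f_R0 (fun k => A0 m k + P0 m k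
      + match m with O => 0 | S m' => c (S m') k / (INR (fact m') * INR (fact k))
           * (PS_pow tau m' * PS_pow sig k * tail a')%fnum n end
      + match k with O => 0 | S k' => BP m k' end) n).
    * apply sum_eq; intros k _; unfold fadd at 1 2.
      rewrite !fconst_mul; unfold fadd.
      replace (fconst (INR m) * (PS_pow tau (pred m) * tail a') * PS_pow sig k)%fnum
        with (fconst (INR m) * (PS_pow tau (pred m) * PS_pow sig k * tail a'))%fnum
        by ring.
      replace (PS_pow tau m * (fconst (INR k) * (PS_pow sig (pred k) * tail p')))%fnum
        with (fconst (INR k) * (PS_pow tau m * PS_pow sig (pred k) * tail p'))%fnum
        by ring.
      rewrite !fconst_mul. unfold A0, P0, BP. fold (c m k) (c (S m) k) (c m (S k)).
      destruct m as [|m], k as [|k]; simpl pred; rewrite ?fact_S_INR;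
        try change (INR 0) with 0; field; repeat split;
        try apply Fm; apply not_0_INR; lia.
    * rewrite !sum_plus. f_equal. f_equal.
      destruct m; [apply sum_f_R0_zero; reflexivity | reflexivity].
  + rewrite !sum_plus.
    assert (E1 := sum_f_R0_pred BA n). rewrite HA in E1.
    assert (E2 : forall m, sum_f_R0 (fun k => match k with O => 0 | S k' => BP m k' end) n
                 = sum_f_R0 (BP m) n).
    { intros m; rewrite <- (sum_f_R0_pred (BP m) n), HP; ring. }
    rewrite (sum_eq (fun m => sum_f_R0 (fun k => match k with O => 0 | S k' => BP m k' end) n)
               (fun m => sum_f_R0 (BP m) n)) by (intros; apply E2).
    replace (sum_f_R0 (fun m => match m with O => 0 | S m' => BA m' end) n)
      with (sum_f_R0 BA n) by lra.
    rewrite <- !sum_plus. apply sum_eq; intros m _.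
    unfold BA. rewrite <- !sum_plus. apply sum_eq; intros k _.
    unfold taylor_term; fold tau sig; rewrite pd_dA, pd_dphi by exact HF.
    fold (c (S m) k) (c m (S k)).
    match goal with |- _ = ?X n + ?Y n =>
      replace X with
        (fconst (c (S m) k / (INR (fact m) * INR (fact k)))
         * (fconst (a' O) * (PS_pow tau m * PS_pow sig k)
            + PS_pow tau m * PS_pow sig k * tail a'))%fnum
        by (rewrite (fconst_tail a') at 3; ring);
      replace Y with
        (fconst (c m (S k) / (INR (fact m) * INR (fact k)))
         * (fconst (p' O) * (PS_pow tau m * PS_pow sig k)
            + PS_pow tau m * PS_pow sig k * tail p'))%fnum
        by (rewrite (fconst_tail p') at 3; ring)
    end.
    rewrite !fconst_mul; unfold fadd; rewrite !fconst_mul.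
    unfold A0, P0, BP; ring.
Qed.

(** The sum of the [e k] times eps^k. [feval] has this form, and [diag_split] is Horner's rule for
    it. *)
Definition diag (e : nat -> fnum) : fnum :=
  fun n => sum_f_R0 (fun k => e k (n - k)%nat) n.

Lemma diag_S (e : nat -> fnum) (n : nat) :
  diag e (S n) = e O (S n) + diag (fun k => e (S k)) n.
Proof. unfold diag; rewrite decomp_sum by lia; reflexivity. Qed.

Lemma diag_split (e : nat -> fnum) :
  diag e = (e O + eps * diag (fun k => e (S k)))%fnum.
Proof.
apply functional_extensionality; intros [|n]; unfold fadd.
- rewrite eps_mul_0; unfold diag; simpl; ring.
- rewrite eps_mul_S; apply diag_S.
Qed.

Lemma diag_mul (e : nat -> fnum) (b : fnum) :
  (diag e * b)%fnum = diag (fun k => e k * b)%fnum.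
Proof.
apply functional_extensionality; intros n; revert e.
induction n as [|n IH]; intros e; [reflexivity|].
rewrite diag_split at 1; rewrite diag_S, <- IH.
replace ((e O + eps * diag (fun k => e (S k))) * b)%fnum
  with (e O * b + eps * (diag (fun k => e (S k)) * b))%fnum by ring.
unfold fadd; rewrite eps_mul_S; reflexivity.
Qed.

Lemma diag_add (e f : nat -> fnum) :
  diag (fun k => e k + f k)%fnum = (diag e + diag f)%fnum.
Proof.
apply functional_extensionality; intros n; apply sum_plus.
Qed.

(** * Algebra and differential calculus of formal series of smooth functions *)

Definition smoothS (S : fseries) : Prop := forall k, smooth (S k).

Definition at_pt (S : fseries) (x y : R) : fnum := fun n => S n x y.

Definition addS (S T : fseries) : fseries :=
  fun n x y => (at_pt S x y + at_pt T x y)%fnum n.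

Definition mulS (S T : fseries) : fseries :=
  fun n x y => (at_pt S x y * at_pt T x y)%fnum n.

Definition cstS (c : fnum) : fseries := fun n _ _ => c n.

(** With [angS], the two coordinate functions: they allow translations and arguments such as (A_0',
    phi') to be written with [compS]. *)
Definition actS : fseries := fun n x _ => fconst x n.

Definition angS : fseries := fun n _ y => fconst y n.

Definition compS (S a p : fseries) : fseries :=
  fun n x y => feval S (at_pt a x y) (at_pt p x y) n.

Lemma smoothS_fdA (S : fseries) : smoothS S -> smoothS (fdA S).
Proof. intros H k; apply smooth_dA, H. Qed.

Lemma smoothS_fdphi (S : fseries) : smoothS S -> smoothS (fdphi S).
Proof. intros H k; apply smooth_dphi, H. Qed.

Lemma smoothS_addS (S T : fseries) : smoothS S -> smoothS T -> smoothS (addS S T).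
Proof. intros HS HT k; exact (smooth_add _ _ (HS k) (HT k)). Qed.

Lemma smoothS_mulS (S T : fseries) : smoothS S -> smoothS T -> smoothS (mulS S T).
Proof.
intros HS HT n; apply smooth_sum; intros k.
apply smooth_mul; [apply HS | apply HT].
Qed.

Lemma smoothS_cstS (c : fnum) : smoothS (cstS c).
Proof. intros k; exact (smooth_const (c k)). Qed.

Lemma smoothS_actS : smoothS actS.
Proof. intros [|k]; [exact smooth_fst | exact (smooth_const 0)]. Qed.

Lemma smoothS_angS : smoothS angS.
Proof. intros [|k]; [exact smooth_snd | exact (smooth_const 0)]. Qed.

Lemma smooth_tail_pow (a : fseries) (m n : nat) :
  smoothS a -> smooth (fun x y => PS_pow (tail (at_pt a x y)) m n).
Proof.
intros Ha; revert n; induction m as [|m IH]; intros n; [exact (smooth_const (PS_one n))|].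
apply (smooth_sum (fun k x y =>
  tail (at_pt a x y) k * PS_pow (tail (at_pt a x y)) m (n - k)%nat)).
intros k; apply smooth_mul; [|apply IH].
destruct k; [exact (smooth_const 0) | apply Ha].
Qed.

Lemma smoothS_compS (S a p : fseries) :
  smoothS S -> smoothS a -> smoothS p -> smoothS (compS S a p).
Proof.
intros HS Ha Hp n.
apply (smooth_sum (fun k x y => feval1 (S k) (at_pt a x y) (at_pt p x y) (n - k)%nat)).
intros k; unfold feval1.
apply (smooth_sum (fun m x y => sum_f_R0 (fun j =>
  partial_derive m j (S k) (a O x y) (p O x y) / (INR (fact m) * INR (fact j))
  * PS_mult (PS_pow (tail (at_pt a x y)) m) (PS_pow (tail (at_pt p x y)) j) (n - k)%nat)
  (n - k)%nat)); intros m.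
apply (smooth_sum (fun j x y =>
  partial_derive m j (S k) (a O x y) (p O x y) / (INR (fact m) * INR (fact j))
  * PS_mult (PS_pow (tail (at_pt a x y)) m) (PS_pow (tail (at_pt p x y)) j) (n - k)%nat));
  intros j.
apply smooth_mul.
- apply smooth_mul; [|apply smooth_const].
  apply (smooth_comp _ (a O) (p O)); [apply smooth_pd, HS | apply Ha | apply Hp].
- apply (smooth_sum (fun i x y => PS_pow (tail (at_pt a x y)) m i
    * PS_pow (tail (at_pt p x y)) j (n - k - i)%nat)); intros i.
  apply smooth_mul; apply smooth_tail_pow; assumption.
Qed.

Lemma fder_at_A (S : fseries) (x y : R) :
  smoothS S -> fder (fun t => at_pt S t y) x (at_pt (fdA S) x y).
Proof. intros H n; apply (smooth_is_dA (S n)), H. Qed.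

Lemma fder_at_phi (S : fseries) (x y : R) :
  smoothS S -> fder (fun t => at_pt S x t) y (at_pt (fdphi S) x y).
Proof. intros H n; apply (smooth_is_dphi (S n)), H. Qed.

Lemma fdA_unique (S T : fseries) :
  (forall x y, fder (fun t => at_pt S t y) x (at_pt T x y)) -> fdA S = T.
Proof.
intros H; apply functional_extensionality; intros n; apply dA_unique.
intros x y; apply H.
Qed.

Lemma fdphi_unique (S T : fseries) :
  (forall x y, fder (fun t => at_pt S x t) y (at_pt T x y)) -> fdphi S = T.
Proof.
intros H; apply functional_extensionality; intros n; apply dphi_unique.
intros x y; apply H.
Qed.

Lemma feval_fder (S : fseries) (a p : R -> fnum) (t : R) (a' p' : fnum) :
  smoothS S -> fder a t a' -> fder p t p' ->
  fder (fun s => feval S (a s) (p s)) t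
    (feval (fdA S) (a t) (p t) * a' + feval (fdphi S) (a t) (p t) * p')%fnum.
Proof.
intros HS Ha Hp n.
change (feval (fdA S) (a t) (p t)) with (diag (fun k => feval1 (dA (S k)) (a t) (p t))).
change (feval (fdphi S) (a t) (p t)) with (diag (fun k => feval1 (dphi (S k)) (a t) (p t))).
rewrite !diag_mul, <- diag_add.
apply (is_derive_sum_f_R0 (fun k s => feval1 (S k) (a s) (p s) (n - k)%nat)).
intros k _; apply feval1_fder; [apply HS | assumption..].
Qed.

Lemma fdA_addS (S T : fseries) :
  smoothS S -> smoothS T -> fdA (addS S T) = addS (fdA S) (fdA T).
Proof.
intros HS HT; apply fdA_unique; intros x y.
apply (fder_add (fun t => at_pt S t y) (fun t => at_pt T t y)); apply fder_at_A; assumption.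
Qed.

Lemma fdphi_addS (S T : fseries) :
  smoothS S -> smoothS T -> fdphi (addS S T) = addS (fdphi S) (fdphi T).
Proof.
intros HS HT; apply fdphi_unique; intros x y.
apply (fder_add (fun t => at_pt S x t) (fun t => at_pt T x t)); apply fder_at_phi; assumption.
Qed.

Lemma fdA_mulS (S T : fseries) :
  smoothS S -> smoothS T -> fdA (mulS S T) = addS (mulS (fdA S) T) (mulS S (fdA T)).
Proof.
intros HS HT; apply fdA_unique; intros x y.
apply (fder_mul (fun t => at_pt S t y) (fun t => at_pt T t y)); apply fder_at_A; assumption.
Qed.

Lemma fdphi_mulS (S T : fseries) :
  smoothS S -> smoothS T -> fdphi (mulS S T) = addS (mulS (fdphi S) T) (mulS S (fdphi T)).
Proof.
intros HS HT; apply fdphi_unique; intros x y.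
apply (fder_mul (fun t => at_pt S x t) (fun t => at_pt T x t)); apply fder_at_phi; assumption.
Qed.

Lemma fdA_compS (S a p : fseries) :
  smoothS S -> smoothS a -> smoothS p ->
  fdA (compS S a p)
  = addS (mulS (compS (fdA S) a p) (fdA a)) (mulS (compS (fdphi S) a p) (fdA p)).
Proof.
intros HS Ha Hp; apply fdA_unique; intros x y.
apply (feval_fder S (fun t => at_pt a t y) (fun t => at_pt p t y));
  [exact HS | apply fder_at_A; assumption..].
Qed.

Lemma fdphi_compS (S a p : fseries) :
  smoothS S -> smoothS a -> smoothS p ->
  fdphi (compS S a p)
  = addS (mulS (compS (fdA S) a p) (fdphi a)) (mulS (compS (fdphi S) a p) (fdphi p)).
Proof.
intros HS Ha Hp; apply fdphi_unique; intros x y.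
apply (feval_fder S (fun t => at_pt a x t) (fun t => at_pt p x t));
  [exact HS | apply fder_at_phi; assumption..].
Qed.

Lemma fdA_cstS (c : fnum) : fdA (cstS c) = cstS (fconst 0).
Proof. apply fdA_unique; intros x y; apply (fder_cst c). Qed.

Lemma fdphi_cstS (c : fnum) : fdphi (cstS c) = cstS (fconst 0).
Proof. apply fdphi_unique; intros x y; apply (fder_cst c). Qed.

Lemma fdA_actS : fdA actS = cstS (fconst 1).
Proof. apply fdA_unique; intros x y; exact (fder_fconst (fun t => t) x 1 (is_derive_id x)). Qed.

Lemma fdphi_actS : fdphi actS = cstS (fconst 0).
Proof. apply fdphi_unique; intros x y; apply (fder_cst (fconst x)). Qed.

Lemma fdA_angS : fdA angS = cstS (fconst 0).
Proof. apply fdA_unique; intros x y; apply (fder_cst (fconst y)). Qed.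

Lemma fdphi_angS : fdphi angS = cstS (fconst 1).
Proof. apply fdphi_unique; intros x y; exact (fder_fconst (fun t => t) y 1 (is_derive_id y)). Qed.

(** * Laws of substitution at formal points *)

Lemma tail_fconst (x : R) : tail (fconst x) = fconst 0.
Proof. apply functional_extensionality; intros [|n]; reflexivity. Qed.

(** Both tails vanish at a real point, so only the Taylor term of index (0, 0) survives. *)
Lemma feval_fconst (G : fseries) (x y : R) : feval G (fconst x) (fconst y) = at_pt G x y.
Proof.
assert (E : forall F n, feval1 F (fconst x) (fconst y) n = fconst (F x y) n).
{ intros F n; unfold feval1; rewrite !tail_fconst.
  assert (Z : forall m k, (0 < m + k)%nat ->
    PS_mult (PS_pow (fconst 0) m) (PS_pow (fconst 0) k) = fconst 0).
  { assert (W : forall m, PS_pow (fconst 0) (S m) = fconst 0)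
      by (intros m; exact (fconst_0_mul _)).
    intros [|m] [|k] H; try lia; rewrite !W;
      [change (PS_mult ?a ?b) with (fmul a b) .. ]; try apply fconst_0_mul.
    rewrite fmul_comm; apply fconst_0_mul. }
  rewrite (sum_f_R0_trunc _ 0 n); [| lia |].
  - change (sum_f_R0 ?f 0) with (f O); cbv beta.
    rewrite (sum_f_R0_trunc _ 0 n); [| lia |].
    + change (sum_f_R0 ?f 0) with (f O); cbv beta.
      change (PS_mult (PS_pow (fconst 0) 0) (PS_pow (fconst 0) 0) n)
        with ((fconst 1 * fconst 1)%fnum n).
      rewrite fconst_mul; unfold partial_derive; destruct n; simpl; field.
    + intros k Hk; rewrite Z by lia; destruct n; simpl; ring.
  - intros m Hm; apply sum_f_R0_zero; intros k _; rewrite Z by lia.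
    destruct n; simpl; ring. }
apply functional_extensionality; intros n; unfold feval.
rewrite (sum_eq _ (fun k => fconst (G k x y) (n - k)%nat)) by (intros; apply E).
unfold at_pt; destruct n as [|n]; [reflexivity|].
rewrite tech5, sum_f_R0_zero.
- rewrite Nat.sub_diag; simpl; ring.
- intros k Hk; replace (S n - k)%nat with (S (n - k)) by lia; reflexivity.
Qed.

(* A formal point is joined to its constant term by the ray [t |-> x_0 + t (x - x_0)].
   Both sides of an identity between substitutions agree at t = 0, and the t-derivative
   of their difference is O(eps) times differences of the same kind, so all the
   coefficients of the difference vanish one after the other. *)
Definition ray (u : fnum) (t : R) : fnum := (fconst (u O) + fconst t * tail u)%fnum.

Lemma ray_0 (u : fnum) : ray u 0 = fconst (u O).
Proof. unfold ray; ring. Qed.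

Lemma ray_1 (u : fnum) : ray u 1 = u.
Proof.
unfold ray; change (fconst 1) with PS_one; rewrite (fconst_tail u) at 3; ring.
Qed.

Lemma fder_ray (u : fnum) (t : R) : fder (ray u) t (tail u).
Proof.
eapply fder_eq.
- apply (fder_add (fun _ => fconst (u O)) (fun s => fconst s * tail u)%fnum).
  + apply fder_cst.
  + apply (fder_mul fconst (fun _ => tail u)); [|apply fder_cst].
    exact (fder_fconst (fun s => s) t 1 (is_derive_id t)).
- reflexivity.
- change (fconst 1) with PS_one; ring.
Qed.

Lemma vanish_tail (u : fnum) : vanish 1 (tail u).
Proof. intros k Hk; replace k with O by lia; reflexivity. Qed.

Lemma vanish_mul_S (n : nat) (a b : fnum) :
  vanish n a -> vanish 1 b -> vanish (S n) (a * b)%fnum.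
Proof. intros; rewrite <- Nat.add_1_r; apply vanish_mul; assumption. Qed.

(** [P] gathers the defects of one law for all series concerned, since differentiating a defect
    along a ray produces defects of the derived series; the induction on the order is therefore
    uniform over [P]. *)
Lemma vanish_family (P : (R -> fnum) -> Prop) :
  (forall D, P D -> D 0 = fconst 0) ->
  (forall D, P D -> exists D', (forall t, fder D t (D' t)) /\
     forall n, (forall E, P E -> forall t, vanish n (E t)) ->
     forall t, vanish (S n) (D' t)) ->
  forall D t, P D -> D t = fconst 0.
Proof.
intros H0 H1.
assert (V : forall n D, P D -> forall t, vanish n (D t)).
{ induction n as [|n IH]; intros D HD t k Hk; [lia|].
  destruct (H1 D HD) as (D' & HD' & HV).
  rewrite (fder_zero_const D k).
  - rewrite H0 by exact HD; destruct k; reflexivity.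
  - intros s; rewrite <- (HV n IH s k Hk); apply HD'. }
intros D t HD; apply functional_extensionality; intros n.
rewrite (V (S n) D HD t n) by lia; destruct n; reflexivity.
Qed.

Lemma fsub_eq_0 (a b : fnum) : (a - b)%fnum = fconst 0 -> a = b.
Proof.
intros H; transitivity ((a - b) + b)%fnum; [ring | rewrite H; ring].
Qed.

Lemma feval_cstS (c u v : fnum) : feval (cstS c) u v = c.
Proof.
apply fsub_eq_0; rewrite <- (ray_1 u), <- (ray_1 v).
apply (vanish_family
  (* The class contains every constant because differentiation replaces [c] by 0. *)
  (fun D => exists c, D = fun t => feval (cstS c) (ray u t) (ray v t) - c)%fnum)
  with (D := fun t => (feval (cstS c) (ray u t) (ray v t) - c)%fnum);
  [| | exists c; reflexivity].
- intros D [d ->]; rewrite !ray_0, feval_fconst; unfold at_pt, cstS.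
  change (fun n => d n) with d; ring.
- intros D [d ->]; eexists; split.
  + intros t; apply (fder_sub (fun t => feval (cstS d) (ray u t) (ray v t)) (fun _ => d)).
    * apply feval_fder; [apply smoothS_cstS | apply fder_ray..].
    * apply fder_cst.
  + intros n HV t; rewrite fdA_cstS, fdphi_cstS.
    assert (W := HV _ (ex_intro _ (fconst 0) eq_refl) t); cbv beta in W.
    replace (_ - fconst 0)%fnum with
      ((feval (cstS (fconst 0)) (ray u t) (ray v t) - fconst 0) * tail u
      + (feval (cstS (fconst 0)) (ray u t) (ray v t) - fconst 0) * tail v)%fnum by ring.
    apply vanish_add; apply vanish_mul_S; auto using vanish_tail.
Qed.

Lemma feval_actS (u v : fnum) : feval actS u v = u.
Proof.
apply fsub_eq_0; rewrite <- (ray_1 u), <- (ray_1 v).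
apply (vanish_family
  (fun D => D = fun t => feval actS (ray u t) (ray v t) - ray u t)%fnum)
  with (D := fun t => (feval actS (ray u t) (ray v t) - ray u t)%fnum);
  [| | reflexivity].
- intros D ->; rewrite !ray_0, feval_fconst; unfold at_pt, actS.
  change (fun n => fconst (u O) n) with (fconst (u O)); ring.
- intros D ->; eexists; split.
  + intros t; apply (fder_sub (fun t => feval actS (ray u t) (ray v t)) (ray u)).
    * apply feval_fder; [apply smoothS_actS | apply fder_ray..].
    * apply fder_ray.
  + intros n _ t; rewrite fdA_actS, fdphi_actS, !feval_cstS.
    change (fconst 1) with PS_one.
    replace (_ - tail u)%fnum with (fconst 0) by ring.
    intros [|k] _; reflexivity.
Qed.

Lemma feval_angS (u v : fnum) : feval angS u v = v.
Proof.
apply fsub_eq_0; rewrite <- (ray_1 u), <- (ray_1 v).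
apply (vanish_family
  (fun D => D = fun t => feval angS (ray u t) (ray v t) - ray v t)%fnum)
  with (D := fun t => (feval angS (ray u t) (ray v t) - ray v t)%fnum);
  [| | reflexivity].
- intros D ->; rewrite !ray_0, feval_fconst; unfold at_pt, angS.
  change (fun n => fconst (v O) n) with (fconst (v O)); ring.
- intros D ->; eexists; split.
  + intros t; apply (fder_sub (fun t => feval angS (ray u t) (ray v t)) (ray v)).
    * apply feval_fder; [apply smoothS_angS | apply fder_ray..].
    * apply fder_ray.
  + intros n _ t; rewrite fdA_angS, fdphi_angS, !feval_cstS.
    change (fconst 1) with PS_one.
    replace (_ - tail v)%fnum with (fconst 0) by ring.
    intros [|k] _; reflexivity.
Qed.

Lemma feval_addS (S T : fseries) (u v : fnum) :
  smoothS S -> smoothS T ->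
  feval (addS S T) u v = (feval S u v + feval T u v)%fnum.
Proof.
intros HS HT; apply fsub_eq_0; rewrite <- (ray_1 u), <- (ray_1 v).
pose (E := fun S T t => (feval (addS S T) (ray u t) (ray v t)
  - (feval S (ray u t) (ray v t) + feval T (ray u t) (ray v t)))%fnum).
apply (vanish_family (fun D => exists S T, smoothS S /\ smoothS T /\ D = E S T))
  with (D := E S T); [| | eauto]; clear S T HS HT.
- intros D (S & T & HS & HT & ->); unfold E; rewrite !ray_0, !feval_fconst.
  change (at_pt (addS S T)) with (fun x y => at_pt S x y + at_pt T x y)%fnum; cbv beta; ring.
- intros D (S & T & HS & HT & ->).
  exists (fun t => E (fdA S) (fdA T) t * tail u + E (fdphi S) (fdphi T) t * tail v)%fnum; split.
  + intros t; unfold E; eapply fder_eq.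
    * apply (fder_sub (fun t => feval (addS S T) (ray u t) (ray v t))
        (fun t => feval S (ray u t) (ray v t) + feval T (ray u t) (ray v t))%fnum);
      [| apply (fder_add (fun t => feval S (ray u t) (ray v t))
             (fun t => feval T (ray u t) (ray v t)))];
      apply feval_fder; try apply fder_ray; auto using smoothS_addS.
    * reflexivity.
    * rewrite fdA_addS, fdphi_addS by assumption; ring.
  + intros n HV t; apply vanish_add; apply vanish_mul_S; try apply vanish_tail;
      apply HV; eauto 8 using smoothS_fdA, smoothS_fdphi.
Qed.

(** The Leibniz rule expresses the derivative of the defect of (S, T) by the defects of the pairs in
    which one factor is differentiated. *)
Lemma feval_mulS (S T : fseries) (u v : fnum) :
  smoothS S -> smoothS T ->
  feval (mulS S T) u v = (feval S u v * feval T u v)%fnum.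
Proof.
intros HS HT; apply fsub_eq_0; rewrite <- (ray_1 u), <- (ray_1 v).
pose (E := fun S T t => (feval (mulS S T) (ray u t) (ray v t)
  - feval S (ray u t) (ray v t) * feval T (ray u t) (ray v t))%fnum).
apply (vanish_family (fun D => exists S T, smoothS S /\ smoothS T /\ D = E S T))
  with (D := E S T); [| | eauto]; clear S T HS HT.
- intros D (S & T & HS & HT & ->); unfold E; rewrite !ray_0, !feval_fconst.
  change (at_pt (mulS S T)) with (fun x y => at_pt S x y * at_pt T x y)%fnum; cbv beta; ring.
- intros D (S & T & HS & HT & ->).
  exists (fun t => (E (fdA S) T t + E S (fdA T) t) * tail u
              + (E (fdphi S) T t + E S (fdphi T) t) * tail v)%fnum; split.
  + intros t; unfold E; eapply fder_eq.
    * apply (fder_sub (fun t => feval (mulS S T) (ray u t) (ray v t))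
        (fun t => feval S (ray u t) (ray v t) * feval T (ray u t) (ray v t))%fnum);
      [| apply (fder_mul (fun t => feval S (ray u t) (ray v t))
             (fun t => feval T (ray u t) (ray v t)))];
      apply feval_fder; try apply fder_ray; auto using smoothS_mulS.
    * reflexivity.
    * rewrite fdA_mulS, fdphi_mulS, !feval_addS
        by auto using smoothS_mulS, smoothS_fdA, smoothS_fdphi; ring.
  + intros n HV t; apply vanish_add; apply vanish_mul_S; try apply vanish_tail;
      apply vanish_add; apply HV; eauto 8 using smoothS_fdA, smoothS_fdphi.
Qed.

(** Only the outer series varies in the class. The chain rule turns the derivative of its defect
    into the defects of its two partial derivatives, multiplied by the velocities of [a] and [p]
    along the ray, which are divisible by eps. *)
Lemma feval_compS (S a p : fseries) (u v : fnum) :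
  smoothS S -> smoothS a -> smoothS p ->
  feval (compS S a p) u v = feval S (feval a u v) (feval p u v).
Proof.
intros HS Ha Hp; apply fsub_eq_0; rewrite <- (ray_1 u), <- (ray_1 v).
pose (c := fun S t => feval S (ray u t) (ray v t)).
pose (E := fun S t => (c (compS S a p) t - feval S (c a t) (c p t))%fnum).
apply (vanish_family (fun D => exists S, smoothS S /\ D = E S))
  with (D := E S); [| | eauto]; clear S HS.
- intros D (S & HS & ->); unfold E, c; rewrite !ray_0, !feval_fconst.
  change (at_pt (compS S a p)) with (fun x y => feval S (at_pt a x y) (at_pt p x y)).
  cbv beta; ring.
- assert (Hc : forall S t, smoothS S ->
    fder (c S) t (c (fdA S) t * tail u + c (fdphi S) t * tail v)%fnum).
  { intros S t HS; apply feval_fder; [exact HS | apply fder_ray..]. }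
  intros D (S & HS & ->).
  exists (fun t => E (fdA S) t * (c (fdA a) t * tail u + c (fdphi a) t * tail v)
              + E (fdphi S) t * (c (fdA p) t * tail u + c (fdphi p) t * tail v))%fnum; split.
  + intros t; eapply fder_eq.
    * apply (fder_sub (c (compS S a p)) (fun t => feval S (c a t) (c p t))).
      -- apply Hc, smoothS_compS; assumption.
      -- apply feval_fder; [|apply Hc..]; assumption.
    * reflexivity.
    * rewrite fdA_compS, fdphi_compS by assumption.
      unfold E, c; rewrite !feval_addS, !feval_mulS
        by auto 6 using smoothS_mulS, smoothS_fdA, smoothS_fdphi, smoothS_compS; ring.
  + intros n HV t; apply vanish_add; apply vanish_mul_S;
      try (apply HV; eauto 8 using smoothS_fdA, smoothS_fdphi);
      apply vanish_add; apply (vanish_mul 0 1); try apply vanish_tail;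
      intros k Hk; lia.
Qed.

Lemma fseries_ext (S T : fseries) :
  (forall x y, at_pt S x y = at_pt T x y) -> S = T.
Proof.
intros H; apply functional_extensionality; intros n; apply fun2_ext; intros x y.
exact (f_equal (fun z : fnum => z n) (H x y)).
Qed.

Lemma at_addS (S T : fseries) (x y : R) :
  at_pt (addS S T) x y = (at_pt S x y + at_pt T x y)%fnum.
Proof. reflexivity. Qed.

Lemma at_mulS (S T : fseries) (x y : R) :
  at_pt (mulS S T) x y = (at_pt S x y * at_pt T x y)%fnum.
Proof. reflexivity. Qed.

Lemma at_compS (S a p : fseries) (x y : R) :
  at_pt (compS S a p) x y = feval S (at_pt a x y) (at_pt p x y).
Proof. reflexivity. Qed.

Lemma at_cstS (c : fnum) (x y : R) : at_pt (cstS c) x y = c.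
Proof. reflexivity. Qed.

Lemma at_actS (x y : R) : at_pt actS x y = fconst x.
Proof. reflexivity. Qed.

Lemma at_angS (x y : R) : at_pt angS x y = fconst y.
Proof. reflexivity. Qed.

(** * Fixed points of eps-adic contractions *)

Definition agree (n : nat) (a b : fnum) : Prop := forall k, (k < n)%nat -> a k = b k.

Lemma agree_refl (n : nat) (a : fnum) : agree n a a.
Proof. intros k _; reflexivity. Qed.

Lemma agree_le (m n : nat) (a b : fnum) : (m <= n)%nat -> agree n a b -> agree m a b.
Proof. intros H Hab k Hk; apply Hab; lia. Qed.

Lemma agree_add (n : nat) (a a' b b' : fnum) :
  agree n a a' -> agree n b b' -> agree n (a + b)%fnum (a' + b')%fnum.
Proof. intros Ha Hb k Hk; unfold fadd; rewrite Ha, Hb by exact Hk; reflexivity. Qed.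

Lemma agree_mul (n : nat) (a a' b b' : fnum) :
  agree n a a' -> agree n b b' -> agree n (a * b)%fnum (a' * b')%fnum.
Proof.
intros Ha Hb k Hk; apply sum_eq; intros i Hi.
rewrite Ha, Hb by lia; reflexivity.
Qed.

Lemma agree_vanish_mul (n : nat) (c a b : fnum) :
  c O = 0 -> agree n a b -> agree (S n) (c * a)%fnum (c * b)%fnum.
Proof.
intros Hc Hab k Hk.
assert (V : vanish (S n) (c * (a - b))%fnum).
{ apply (vanish_mul 1 n).
  - intros j Hj; replace j with O by lia; exact Hc.
  - intros j Hj; unfold fsub; rewrite Hab by exact Hj; ring. }
specialize (V k Hk).
replace (c * (a - b))%fnum with (c * a - c * b)%fnum in V by ring.
unfold fsub in V; lra.
Qed.

Lemma agree_pow_tail (n m : nat) (a b : fnum) :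
  agree n a b -> agree n (PS_pow (tail a) m) (PS_pow (tail b) m).
Proof.
intros H; induction m as [|m IH]; [apply agree_refl|].
apply agree_mul; [|exact IH].
intros [|k] Hk; simpl; [reflexivity | apply H, Hk].
Qed.

Lemma agree_feval1 (n : nat) (F : R -> R -> R) (a a' p p' : fnum) :
  agree n a a' -> agree n p p' -> agree n (feval1 F a p) (feval1 F a' p').
Proof.
intros Ha Hp k Hk; unfold feval1.
rewrite (Ha O), (Hp O) by lia.
apply sum_eq; intros m _; apply sum_eq; intros j _; f_equal.
apply (agree_mul n); [apply agree_pow_tail, Ha | apply agree_pow_tail, Hp | exact Hk].
Qed.

Lemma agree_feval (n : nat) (S : fseries) (a a' p p' : fnum) :
  agree n a a' -> agree n p p' -> agree n (feval S a p) (feval S a' p').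
Proof.
intros Ha Hp k Hk; apply sum_eq; intros i Hi.
apply (agree_feval1 n); [assumption..|lia].
Qed.

(** One application gains one order in eps. The index set [I] numbers the unknowns of a system. *)
Definition contraction {I : Type} (Psi : (I -> fnum) -> I -> fnum) : Prop :=
  forall n z w, (forall i, agree n (z i) (w i)) ->
  forall i, agree (S n) (Psi z i) (Psi w i).

Definition approx {I : Type} (Psi : (I -> fnum) -> I -> fnum) (n : nat) : I -> fnum :=
  Nat.iter n Psi (fun _ => fconst 0).

(** The coefficients below [n] are settled after [n] iterations from zero, so coefficient [n] is
    read in iterate [S n]. Each coefficient thus comes from finitely many iterations, which later
    gives smooth dependence on parameters. *)
Definition fixpt {I : Type} (Psi : (I -> fnum) -> I -> fnum) : I -> fnum :=
  fun i n => approx Psi (S n) i n.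

Lemma fixpt_unique {I : Type} (Psi : (I -> fnum) -> I -> fnum) (z w : I -> fnum) :
  contraction Psi -> (forall i, z i = Psi z i) -> (forall i, w i = Psi w i) ->
  forall i, z i = w i.
Proof.
intros HP Hz Hw i; apply functional_extensionality; intros n.
assert (A : forall n i, agree n (z i) (w i)).
{ clear n i; induction n as [|n IH]; intros i.
  - intros k Hk; lia.
  - rewrite Hz, Hw; apply HP, IH. }
apply (A (S n) i n); lia.
Qed.

Lemma fixpt_eq {I : Type} (Psi : (I -> fnum) -> I -> fnum) :
  contraction Psi -> forall i, fixpt Psi i = Psi (fixpt Psi) i.
Proof.
intros HP.
assert (A : forall n i, agree n (approx Psi n i) (approx Psi (S n) i)).
{ induction n as [|n IH]; intros i; [intros k Hk; lia|].
  exact (HP n _ _ IH i). }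
assert (B : forall m n i, (n <= m)%nat -> agree n (approx Psi n i) (approx Psi m i)).
{ intros m n i H; induction H as [|m H IH]; [apply agree_refl|].
  intros k Hk; rewrite (IH k Hk); apply (agree_le n m); auto. }
assert (C : forall n i, agree n (fixpt Psi i) (approx Psi n i)).
{ intros n i k Hk; apply (B n (S k) i); lia. }
intros i; apply functional_extensionality; intros n.
rewrite (HP n _ _ (C n) i n) by lia; reflexivity.
Qed.

(** * Periodicity *)

Definition perS (S : fseries) : Prop := forall k x y, S k x (y + 2 * PI) = S k x y.

Definition turn : fnum := fconst (2 * PI).

Lemma full_turn_eq (A phi : fnum) : full_turn (A, phi) = (A, (phi + turn)%fnum).
Proof.
apply (f_equal (fun p : fnum => (A, p))).
apply functional_extensionality; intros [|n]; unfold fadd; simpl; ring.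
Qed.

(** Periodicity is known at real points. Stated as invariance of [S] under composition with a
    translation, it passes to formal points by [feval_compS]. *)
Lemma feval_per (S : fseries) (a p : fnum) :
  smoothS S -> perS S -> feval S a (p + turn)%fnum = feval S a p.
Proof.
intros HS HP.
assert (E : compS S actS (addS angS (cstS turn)) = S).
{ apply fseries_ext; intros x y; rewrite at_compS, at_addS, at_actS, at_angS, at_cstS.
  unfold turn; rewrite <- fconst_add, feval_fconst.
  apply functional_extensionality; intros n; apply HP. }
rewrite <- E at 2.
rewrite feval_compS, feval_addS, feval_actS, feval_angS, feval_cstS
  by auto using smoothS_actS, smoothS_angS, smoothS_cstS, smoothS_addS.
reflexivity.
Qed.

Lemma dA_per (F : R -> R -> R) :
  (forall x y, F x (y + 2 * PI) = F x y) ->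
  forall x y, dA F x (y + 2 * PI) = dA F x y.
Proof. intros H x y; apply Derive_ext; intros t; apply H. Qed.

Lemma dphi_per (F : R -> R -> R) :
  smooth F -> (forall x y, F x (y + 2 * PI) = F x y) ->
  forall x y, dphi F x (y + 2 * PI) = dphi F x y.
Proof.
intros HF H x y; symmetry; apply is_derive_unique.
apply (is_derive_ext (fun t => F x (t + 2 * PI))); [intros t; apply H|].
evar_last.
- apply (is_derive_comp (F x) (fun t => t + 2 * PI)).
  + apply smooth_is_dphi, HF.
  + auto_derive; [exact I | reflexivity].
- exact (Rmult_1_l _).
Qed.

Lemma perS_fdA (S : fseries) : perS S -> perS (fdA S).
Proof. intros H k; apply dA_per, H. Qed.

Lemma perS_fdphi (S : fseries) : smoothS S -> perS S -> perS (fdphi S).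
Proof. intros HS H k; apply dphi_per; [apply HS | apply H]. Qed.

(** * Maps generated by A phi + h(A) + eps E(A, phi) *)

Definition liftA (h : R -> R) : fseries := fun k A _ => fconst (h A) k.

Definition smooth1 (h : R -> R) : Prop := smooth (fun A _ => h A).

Lemma smoothS_liftA (h : R -> R) : smooth1 h -> smoothS (liftA h).
Proof. intros H [|k]; [exact H | exact (smooth_const 0)]. Qed.

Lemma perS_liftA (h : R -> R) : perS (liftA h).
Proof. intros k x y; reflexivity. Qed.

Lemma fdphi_liftA (h : R -> R) : fdphi (liftA h) = cstS (fconst 0).
Proof. apply fdphi_unique; intros x y; apply (fder_cst (fconst (h x))). Qed.

(** Common shape of S_c and X. The factor eps in front of [E] makes the implicit equations
    contractions. *)
Definition gen (h : R -> R) (E : fseries) : fseries :=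
  addS (addS (mulS actS angS) (liftA h)) (mulS (cstS eps) E).

Create HintDb smoothS.
#[local] Hint Resolve smoothS_fdA smoothS_fdphi smoothS_addS smoothS_mulS smoothS_cstS
  smoothS_actS smoothS_angS smoothS_compS smoothS_liftA : smoothS.

Lemma smoothS_gen (h : R -> R) (E : fseries) :
  smooth1 h -> smoothS E -> smoothS (gen h E).
Proof. intros; unfold gen; auto 8 with smoothS. Qed.

#[local] Hint Resolve smoothS_gen : smoothS.

Lemma feval_gen (h : R -> R) (E : fseries) (a p : fnum) :
  smooth1 h -> smoothS E ->
  feval (gen h E) a p = (a * p + feval (liftA h) a p + eps * feval E a p)%fnum.
Proof.
intros Hh HE; unfold gen.
rewrite !feval_addS, !feval_mulS, feval_actS, feval_angS, feval_cstS by auto 8 with smoothS.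
reflexivity.
Qed.

Lemma feval_gen_phi (h : R -> R) (E : fseries) (a p : fnum) :
  smooth1 h -> smoothS E ->
  feval (fdphi (gen h E)) a p = (a + eps * feval (fdphi E) a p)%fnum.
Proof.
intros Hh HE; unfold gen.
rewrite !fdphi_addS, !fdphi_mulS, fdphi_liftA, fdphi_actS, fdphi_angS, fdphi_cstS
  by auto 8 with smoothS.
rewrite !feval_addS, !feval_mulS, feval_actS, feval_angS, !feval_cstS by auto 8 with smoothS.
change (fconst 1) with PS_one; ring.
Qed.

Lemma feval_gen_A (h : R -> R) (E : fseries) (a p : fnum) :
  smooth1 h -> smoothS E ->
  feval (fdA (gen h E)) a p
  = (p + feval (fdA (liftA h)) a p + eps * feval (fdA E) a p)%fnum.
Proof.
intros Hh HE; unfold gen.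
rewrite !fdA_addS, !fdA_mulS, fdA_actS, fdA_angS, fdA_cstS by auto 8 with smoothS.
rewrite !feval_addS, !feval_mulS, feval_actS, feval_angS, !feval_cstS by auto 8 with smoothS.
change (fconst 1) with PS_one; ring.
Qed.

(** Absorbing the sign lets each contraction be built from sums and from products with a factor of
    zero constant term. *)
Definition neg_eps : fnum := (- eps)%fnum.

Lemma neg_eps_0 : neg_eps O = 0.
Proof. unfold neg_eps, fopp; simpl; ring. Qed.

Definition act_eq (E : fseries) (A phi : fnum) (z : unit -> fnum) : unit -> fnum :=
  fun _ => (A + neg_eps * feval (fdphi E) (z tt) phi)%fnum.

Lemma act_eq_contraction (E : fseries) (A phi : fnum) : contraction (act_eq E A phi).
Proof.
intros n z w H i; apply agree_add; [apply agree_refl|].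
apply agree_vanish_mul; [apply neg_eps_0|].
apply agree_feval; [apply H | apply agree_refl].
Qed.

Definition gen_map (h : R -> R) (E : fseries) (x : fpoint) : fpoint :=
  let A' := fixpt (act_eq E (fst x) (snd x)) tt in
  (A', feval (fdA (gen h E)) A' (snd x)).

Lemma act_eq_iff (h : R -> R) (E : fseries) (A phi A' : fnum) :
  smooth1 h -> smoothS E ->
  A = feval (fdphi (gen h E)) A' phi <-> A' = fixpt (act_eq E A phi) tt.
Proof.
intros Hh HE; rewrite feval_gen_phi by assumption; split; intros H.
- apply (fixpt_unique (act_eq E A phi) (fun _ => A')).
  + apply act_eq_contraction.
  + intros i; unfold act_eq, neg_eps; rewrite H at 1; ring.
  + apply fixpt_eq, act_eq_contraction.
- rewrite H; rewrite (fixpt_eq _ (act_eq_contraction E A phi)) at 1.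
  unfold act_eq at 1, neg_eps; ring.
Qed.

Lemma gen_map_graph (h : R -> R) (E : fseries) (x x' : fpoint) :
  smooth1 h -> smoothS E ->
  gen_map h E x = x' <-> generates (gen h E) x x'.
Proof.
intros Hh HE; destruct x as [A phi], x' as [A' phi'].
unfold generates, gen_map; simpl; rewrite act_eq_iff by assumption.
split.
- intros H; injection H as <- <-; split; reflexivity.
- intros [<- ->]; reflexivity.
Qed.

(** The graph is invariant under a simultaneous full turn of source and image, and the graph
    determines the map. *)
Lemma gen_map_turn (h : R -> R) (E : fseries) (x : fpoint) :
  smooth1 h -> smoothS E -> perS E ->
  gen_map h E (full_turn x) = full_turn (gen_map h E x).
Proof.
intros Hh HE HP; destruct x as [A phi].
assert (G := proj1 (gen_map_graph h E (A, phi) _ Hh HE) eq_refl).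
destruct (gen_map h E (A, phi)) as [A' phi'].
rewrite !full_turn_eq; apply gen_map_graph; [assumption..|].
destruct G as [G1 G2]; split.
- rewrite G1, !feval_gen_phi, feval_per by auto using perS_fdphi with smoothS; reflexivity.
- rewrite G2, !feval_gen_A, !feval_per
    by auto using perS_fdA, perS_liftA with smoothS; ring.
Qed.

Lemma gen_map_generated (h : R -> R) (E : fseries) :
  smooth1 h -> smoothS E -> perS E -> map_generated_by (gen h E) (gen_map h E).
Proof.
intros Hh HE HP; split; intros.
- apply gen_map_graph; assumption.
- apply gen_map_turn; assumption.
Qed.

Definition zero1 : R -> R := fun _ => 0.

Lemma smooth1_zero1 : smooth1 zero1.
Proof. exact (smooth_const 0). Qed.

#[local] Hint Resolve smooth1_zero1 : smoothS.

Lemma feval_gen0_A (E : fseries) (a p : fnum) :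
  smoothS E -> feval (fdA (gen zero1 E)) a p = (p + eps * feval (fdA E) a p)%fnum.
Proof.
intros HE; rewrite feval_gen_A by auto with smoothS.
replace (fdA (liftA zero1)) with (cstS (fconst 0)).
- rewrite feval_cstS; ring.
- symmetry; apply fdA_unique; intros x y; apply (fder_cst (fconst 0)).
Qed.

Definition ang_eq (E : fseries) (A' phi' : fnum) (z : unit -> fnum) : unit -> fnum :=
  fun _ => (phi' + neg_eps * feval (fdA E) A' (z tt))%fnum.

Lemma ang_eq_contraction (E : fseries) (A' phi' : fnum) : contraction (ang_eq E A' phi').
Proof.
intros n z w H i; apply agree_add; [apply agree_refl|].
apply agree_vanish_mul; [apply neg_eps_0|].
apply agree_feval; [apply agree_refl | apply H].
Qed.

(** Near the identity the relations can also be solved from the image: the angle relation is a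
    contraction in the old angle, after which the old action is explicit. *)
Definition gen0_inv (E : fseries) (x' : fpoint) : fpoint :=
  let phi := fixpt (ang_eq E (fst x') (snd x')) tt in
  (feval (fdphi (gen zero1 E)) (fst x') phi, phi).

Lemma gen0_inv_graph (E : fseries) (x x' : fpoint) :
  smoothS E -> gen0_inv E x' = x <-> generates (gen zero1 E) x x'.
Proof.
intros HE; destruct x as [A phi], x' as [A' phi'].
unfold generates, gen0_inv; simpl.
assert (I : phi' = feval (fdA (gen zero1 E)) A' phi <->
            phi = fixpt (ang_eq E A' phi') tt).
{ rewrite feval_gen0_A by assumption; split; intros H.
  - apply (fixpt_unique (ang_eq E A' phi') (fun _ => phi)).
    + apply ang_eq_contraction.
    + intros i; unfold ang_eq, neg_eps; rewrite H at 1; ring.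
    + apply fixpt_eq, ang_eq_contraction.
  - rewrite H; rewrite (fixpt_eq _ (ang_eq_contraction E A' phi')) at 1.
    unfold ang_eq at 1, neg_eps; ring. }
rewrite I; split.
- intros H; injection H as <- <-; split; reflexivity.
- intros [-> <-]; reflexivity.
Qed.

Lemma gen0_inv_l (E : fseries) (x : fpoint) :
  smoothS E -> gen0_inv E (gen_map zero1 E x) = x.
Proof.
intros HE; apply gen0_inv_graph; [exact HE|].
apply gen_map_graph; auto with smoothS.
Qed.

Lemma gen0_inv_r (E : fseries) (x : fpoint) :
  smoothS E -> gen_map zero1 E (gen0_inv E x) = x.
Proof.
intros HE; apply gen_map_graph; auto with smoothS.
apply gen0_inv_graph; auto.
Qed.

(** * The generating function of the conjugated map *)

(* With A_0', phi_0 given, the remaining variables of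
   (A_0, phi_0) <- (A, phi) -> (A', phi') -> (A_0', phi_0') are determined by
   phi_0 = d_A X(A_0, phi), phi' = d_A S(A', phi), A' = d_phi X(A_0', phi')
   and d_phi S(A', phi) = A = d_phi X(A_0, phi). *)
Inductive mixed_var : Set := A0_var | phi_var | A1_var.

Section Conjugation.

Context (h : R -> R) (E F : fseries)
  (Hh : smooth1 h) (HE : smoothS E) (HF : smoothS F).

Let G := gen h E.
Let X := gen zero1 F.

(** Here (u, v) is (A_0', phi_0). In the equation for A_0 the leading A' is replaced by its own
    right-hand side, since a bare unknown would gain no order in eps. For the same reason phi' is
    not an unknown: its expression occurs only under a factor eps. *)
Definition mixed_eq (u v : fnum) (z : mixed_var -> fnum) : mixed_var -> fnum :=
  let A1 := (u + eps * feval (fdphi F) u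
               (feval (fdA (gen h E)) (z A1_var) (z phi_var)))%fnum in
  fun i => match i with
  | phi_var => v + neg_eps * feval (fdA F) (z A0_var) (z phi_var)
  | A1_var => A1
  | A0_var => A1 + (eps * feval (fdphi E) (z A1_var) (z phi_var)
                    + neg_eps * feval (fdphi F) (z A0_var) (z phi_var))
  end%fnum.

Lemma mixed_eq_contraction (u v : fnum) : contraction (mixed_eq u v).
Proof.
intros n z w H.
assert (E0 : eps O = 0) by reflexivity.
assert (N0 := neg_eps_0).
intros []; simpl; repeat apply agree_add; try apply agree_refl;
  apply agree_vanish_mul; try assumption; repeat apply agree_feval;
  try apply agree_refl; apply H.
Qed.

Definition mixed_sys (u v a q b q' : fnum) : Prop :=
  v = feval (fdA X) a q /\ q' = feval (fdA G) b q /\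
  b = feval (fdphi X) u q' /\ feval (fdphi G) b q = feval (fdphi X) a q.

Lemma mixed_sys_iff (u v : fnum) (z : mixed_var -> fnum) (q' : fnum) :
  mixed_sys u v (z A0_var) (z phi_var) (z A1_var) q' <->
  (forall i, z i = mixed_eq u v z i) /\ q' = feval (fdA G) (z A1_var) (z phi_var).
Proof.
unfold mixed_sys, X, G.
rewrite !feval_gen_phi, feval_gen0_A by auto with smoothS.
assert (P : forall a b c d : fnum, a = (b + (c - d))%fnum <-> (b + c = a + d)%fnum).
{ intros a b c d; split; intros H; [rewrite H; ring|].
  transitivity ((a + d) - d)%fnum; [ring | rewrite <- H; ring]. }
split.
- intros (H1 & H2 & H3 & H4); split; [|exact H2].
  subst q'; intros []; simpl.
  + rewrite <- H3; unfold neg_eps.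
    transitivity ((z A0_var + eps * feval (fdphi F) (z A0_var) (z phi_var))
                  - eps * feval (fdphi F) (z A0_var) (z phi_var))%fnum; [ring|].
    rewrite <- H4; ring.
  + rewrite H1 at 1; unfold neg_eps; ring.
  + exact H3.
- intros [H ->].
  assert (H0 := H A0_var); assert (H1 := H phi_var); assert (H2 := H A1_var).
  clear H; simpl in H0, H1, H2; rewrite <- H2 in H0; unfold neg_eps in H0, H1.
  repeat split; auto.
  + rewrite H1 at 1; ring.
  + rewrite H0 at 1; ring.
Qed.

(** The same right-hand sides for unknown fields. They show that the iterates are smooth, and they
    carry the fixed-point equations from real points to formal ones. *)
Definition mixed_eqS (Z : mixed_var -> fseries) : mixed_var -> fseries :=
  let A1 := addS actS (mulS (cstS eps) (compS (fdphi F) actS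
               (compS (fdA (gen h E)) (Z A1_var) (Z phi_var)))) in
  fun i => match i with
  | phi_var => addS angS (mulS (cstS neg_eps) (compS (fdA F) (Z A0_var) (Z phi_var)))
  | A1_var => A1
  | A0_var => addS A1 (addS (mulS (cstS eps) (compS (fdphi E) (Z A1_var) (Z phi_var)))
                (mulS (cstS neg_eps) (compS (fdphi F) (Z A0_var) (Z phi_var))))
  end.

Lemma smoothS_mixed_eqS (Z : mixed_var -> fseries) :
  (forall i, smoothS (Z i)) -> forall i, smoothS (mixed_eqS Z i).
Proof. intros HZ []; simpl; auto 12 with smoothS. Qed.

Lemma at_mixed_eqS (Z : mixed_var -> fseries) (x y : R) (i : mixed_var) :
  at_pt (mixed_eqS Z i) x y
  = mixed_eq (fconst x) (fconst y) (fun j => at_pt (Z j) x y) i.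
Proof. destruct i; reflexivity. Qed.

Lemma feval_mixed_eqS (Z : mixed_var -> fseries) (u v : fnum) (i : mixed_var) :
  (forall i, smoothS (Z i)) ->
  feval (mixed_eqS Z i) u v = mixed_eq u v (fun j => feval (Z j) u v) i.
Proof.
intros HZ; destruct i; simpl;
  rewrite ?feval_addS, ?feval_mulS, ?feval_compS, ?feval_cstS, ?feval_actS, ?feval_angS
    by auto 12 with smoothS; reflexivity.
Qed.

Definition mixed_field (i : mixed_var) : fseries :=
  fun n x y => fixpt (mixed_eq (fconst x) (fconst y)) i n.

Lemma smoothS_mixed_field (i : mixed_var) : smoothS (mixed_field i).
Proof.
assert (A : forall n, exists Z, (forall i, smoothS (Z i)) /\ forall x y,
  (fun i => at_pt (Z i) x y) = approx (mixed_eq (fconst x) (fconst y)) n).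
{ induction n as [|n (Z & HZ & EZ)].
  - exists (fun _ => cstS (fconst 0)); split; [intros; apply smoothS_cstS|].
    reflexivity.
  - exists (mixed_eqS Z); split; [apply smoothS_mixed_eqS, HZ|].
    intros x y; apply functional_extensionality; intros j.
    rewrite at_mixed_eqS, EZ; reflexivity. }
intros n; destruct (A (S n)) as (Z & HZ & EZ).
apply (smooth_ext (Z i n)); [apply HZ|].
intros x y; unfold mixed_field, fixpt; rewrite <- EZ; reflexivity.
Qed.

#[local] Hint Resolve smoothS_mixed_field : smoothS.

Lemma mixed_field_eq (i : mixed_var) : mixed_field i = mixed_eqS mixed_field i.
Proof.
apply fseries_ext; intros x y; rewrite at_mixed_eqS.
exact (fixpt_eq _ (mixed_eq_contraction (fconst x) (fconst y)) i).
Qed.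

Definition phi1_field : fseries :=
  compS (fdA G) (mixed_field A1_var) (mixed_field phi_var).

Lemma smoothS_phi1_field : smoothS phi1_field.
Proof. unfold phi1_field, G; auto with smoothS. Qed.

#[local] Hint Resolve smoothS_phi1_field : smoothS.

Lemma feval_phi1_field (u v : fnum) :
  feval phi1_field u v
  = feval (fdA G) (feval (mixed_field A1_var) u v) (feval (mixed_field phi_var) u v).
Proof. apply feval_compS; unfold G; auto with smoothS. Qed.

(** The fields are constructed at real points only. Substituting (u, v) in their fixed-point
    equations gives a solution at the formal point, and the contraction there has no other. *)
Lemma mixed_field_sys (u v a q b q' : fnum) :
  mixed_sys u v a q b q' <->
  a = feval (mixed_field A0_var) u v /\ q = feval (mixed_field phi_var) u v /\
  b = feval (mixed_field A1_var) u v /\ q' = feval phi1_field u v.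
Proof.
assert (FX : forall i, feval (mixed_field i) u v
             = mixed_eq u v (fun j => feval (mixed_field j) u v) i).
{ intros i; rewrite mixed_field_eq at 1; apply feval_mixed_eqS; auto with smoothS. }
rewrite feval_phi1_field; split.
- intros HS.
  pose (z := fun i => match i with A0_var => a | phi_var => q | A1_var => b end).
  apply (mixed_sys_iff u v z) in HS; destruct HS as [Hz ->].
  assert (U := fixpt_unique _ z _ (mixed_eq_contraction u v) Hz FX).
  assert (U0 := U A0_var); assert (U1 := U phi_var); assert (U2 := U A1_var).
  simpl in U0, U1, U2; simpl; rewrite <- U0, <- U1, <- U2; auto.
- intros (-> & -> & -> & ->).
  apply (mixed_sys_iff u v (fun j => feval (mixed_field j) u v)).
  split; [exact FX | reflexivity].
Qed.

Lemma mixed_field_at (x y : R) :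
  mixed_sys (fconst x) (fconst y) (at_pt (mixed_field A0_var) x y)
    (at_pt (mixed_field phi_var) x y) (at_pt (mixed_field A1_var) x y)
    (at_pt phi1_field x y).
Proof. apply mixed_field_sys; rewrite !feval_fconst; auto. Qed.

(* The sum of the generating functions of the three maps composed, completed so that the
   intermediate variables are its critical point. *)
Definition conj_gen : fseries :=
  addS (addS (compS G (mixed_field A1_var) (mixed_field phi_var))
             (compS X actS phi1_field))
    (addS (mulS (mixed_field A0_var) angS)
       (mulS (cstS (- fconst 1)%fnum)
          (addS (mulS (mixed_field A1_var) phi1_field)
                (compS X (mixed_field A0_var) (mixed_field phi_var))))).

Lemma smoothS_conj_gen : smoothS conj_gen.
Proof. unfold conj_gen, G, X; auto 12 with smoothS. Qed.

(** The derivatives of the intermediate fields cancel by [mixed_sys]. The angle occurs explicitly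
    only in A_0 phi_0, which leaves A_0. *)
Lemma fdphi_conj_gen : fdphi conj_gen = mixed_field A0_var.
Proof.
assert (HG : smoothS G) by (unfold G; auto with smoothS).
assert (HX : smoothS X) by (unfold X; auto with smoothS).
unfold conj_gen.
rewrite !fdphi_addS, !fdphi_mulS, !fdphi_addS, !fdphi_mulS, !fdphi_compS, fdphi_cstS,
  fdphi_actS, fdphi_angS by auto 12 with smoothS.
apply fseries_ext; intros x y.
rewrite !at_addS, !at_mulS, !at_addS, !at_mulS, !at_cstS, !at_compS, !at_actS, !at_angS.
destruct (mixed_field_at x y) as (H1 & H2 & H3 & H4).
rewrite <- H1, <- H2, <- H3, H4; change (fconst 1) with PS_one; ring.
Qed.

(** Same cancellation; the action occurs explicitly only as first argument of X(A_0', phi'), and d_A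
    X there is phi_0'. *)
Lemma fdA_conj_gen : fdA conj_gen = compS (fdA X) actS phi1_field.
Proof.
assert (HG : smoothS G) by (unfold G; auto with smoothS).
assert (HX : smoothS X) by (unfold X; auto with smoothS).
unfold conj_gen.
rewrite !fdA_addS, !fdA_mulS, !fdA_addS, !fdA_mulS, !fdA_compS, fdA_cstS,
  fdA_actS, fdA_angS by auto 12 with smoothS.
apply fseries_ext; intros x y.
rewrite !at_addS, !at_mulS, !at_addS, !at_mulS, !at_cstS, !at_compS, !at_actS, !at_angS.
destruct (mixed_field_at x y) as (H1 & H2 & H3 & H4).
rewrite <- H1, <- H2, <- H3, H4; change (fconst 1) with PS_one; ring.
Qed.

(** Eliminating A, the relations of the three maps become [mixed_sys] together with phi_0' = d_A
    X(A_0', phi'), and [mixed_sys] has the fields as its only solution. *)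
Lemma conj_gen_generates (x x' : fpoint) :
  generates conj_gen x x' <->
  exists w w', generates X w x /\ generates G w w' /\ generates X w' x'.
Proof.
assert (HX : smoothS (fdA X)) by (unfold X; auto with smoothS).
destruct x as [a v], x' as [u v'].
unfold generates at 1; rewrite fdphi_conj_gen, fdA_conj_gen, feval_compS, feval_actS
  by auto with smoothS.
split.
- intros [-> ->].
  assert (HS := proj2 (mixed_field_sys u v _ _ _ _)
    (conj eq_refl (conj eq_refl (conj eq_refl eq_refl)))).
  destruct HS as (H1 & H2 & H3 & H4).
  exists (feval (fdphi X) (feval (mixed_field A0_var) u v) (feval (mixed_field phi_var) u v),
          feval (mixed_field phi_var) u v),
    (feval (mixed_field A1_var) u v, feval phi1_field u v).
  repeat split; auto.
- intros ([A q] & [b q'] & [H1 H2] & [H3 H4] & [H5 H6]).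
  assert (HS : mixed_sys u v a q b q') by (repeat split; congruence).
  apply mixed_field_sys in HS; destruct HS as (-> & _ & _ & ->).
  split; [reflexivity | exact H6].
Qed.

Context (PE : perS E) (PF : perS F).

(** Turning both angles by 2 pi maps a solution for the angle y to one for y + 2 pi; uniqueness does
    the rest. *)
Lemma mixed_field_per (x y : R) :
  at_pt (mixed_field A0_var) x (y + 2 * PI) = at_pt (mixed_field A0_var) x y /\
  at_pt (mixed_field phi_var) x (y + 2 * PI) = (at_pt (mixed_field phi_var) x y + turn)%fnum /\
  at_pt (mixed_field A1_var) x (y + 2 * PI) = at_pt (mixed_field A1_var) x y /\
  at_pt phi1_field x (y + 2 * PI) = (at_pt phi1_field x y + turn)%fnum.
Proof.
assert (HS : mixed_sys (fconst x) (fconst (y + 2 * PI)) (at_pt (mixed_field A0_var) x y)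
    (at_pt (mixed_field phi_var) x y + turn)%fnum (at_pt (mixed_field A1_var) x y)
    (at_pt phi1_field x y + turn)%fnum).
{ destruct (mixed_field_at x y) as (H1 & H2 & H3 & H4).
  unfold mixed_sys, X, G in *.
  rewrite !feval_gen_phi, feval_gen0_A, feval_gen_A in * by auto with smoothS.
  rewrite !feval_per by auto using perS_fdA, perS_fdphi, perS_liftA with smoothS.
  rewrite fconst_add, H1, H2 at 1; fold turn.
  repeat split; try assumption; ring. }
apply mixed_field_sys in HS; rewrite !feval_fconst in HS.
destruct HS as (-> & -> & -> & ->); auto.
Qed.

Lemma feval_gen_turn (k : R -> R) (D : fseries) (a p : fnum) :
  smooth1 k -> smoothS D -> perS D ->
  feval (gen k D) a (p + turn)%fnum = (feval (gen k D) a p + turn * a)%fnum.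
Proof.
intros Hk HD PD; rewrite !feval_gen by assumption.
rewrite !feval_per by auto using perS_liftA with smoothS; ring.
Qed.

(** Only products of an action and an angle change, by 2 pi times the action. The five contributions
    A' + A_0' + A_0 - A' - A_0 leave A_0'. *)
Lemma conj_gen_turn (x y : R) :
  at_pt conj_gen x (y + 2 * PI) = (at_pt conj_gen x y + turn * fconst x)%fnum.
Proof.
unfold conj_gen, G, X.
rewrite !at_addS, !at_mulS, !at_addS, !at_mulS, !at_cstS, !at_compS, !at_actS, !at_angS.
destruct (mixed_field_per x y) as (-> & -> & -> & ->).
rewrite !feval_gen_turn, fconst_add by auto with smoothS; fold turn.
change (fconst 1) with PS_one; ring.
Qed.

(** The increment 2 pi A_0' is concentrated in order zero, where S_0 contains A_0' phi_0. *)
Lemma conj_gen_per (k : nat) (x y : R) :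
  conj_gen (S k) x (y + 2 * PI) = conj_gen (S k) x y.
Proof.
assert (H := f_equal (fun z : fnum => z (S k)) (conj_gen_turn x y)); cbv beta in H.
unfold fadd, turn in H; rewrite <- fconst_fmul in H; simpl fconst in H.
unfold at_pt in H; rewrite H; ring.
Qed.

End Conjugation.

(** * Coefficients of low order *)

Lemma fmul_0 (a b : fnum) : (a * b)%fnum O = a O * b O.
Proof. reflexivity. Qed.

Lemma fmul_1 (a b : fnum) : (a * b)%fnum 1%nat = a O * b 1%nat + a 1%nat * b O.
Proof. reflexivity. Qed.

Lemma fmul_2 (a b : fnum) :
  (a * b)%fnum 2%nat = a O * b 2%nat + a 1%nat * b 1%nat + a 2%nat * b O.
Proof. reflexivity. Qed.

Lemma feval_0 (S : fseries) (a p : fnum) : feval S a p O = S O (a O) (p O).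
Proof. cbn; unfold partial_derive, PS_mult; cbn; field. Qed.

Lemma feval_1 (S : fseries) (a p : fnum) :
  feval S a p 1%nat
  = dA (S O) (a O) (p O) * a 1%nat + dphi (S O) (a O) (p O) * p 1%nat
    + S 1%nat (a O) (p O).
Proof.
change (feval S a p 1%nat) with (feval1 (S O) a p 1%nat + feval1 (S 1%nat) a p O).
unfold feval1; simpl sum_f_R0.
change (partial_derive 1 0 (S O)) with (dA (S O)).
change (partial_derive 0 1 (S O)) with (dphi (S O)).
change (partial_derive 0 0 ?F) with F.
unfold PS_mult; simpl; unfold PS_mult; simpl; field.
Qed.

Lemma Derive_n_0 (n : nat) (x : R) : Derive_n (fun _ => 0) n x = 0.
Proof. destruct n; [reflexivity | apply Derive_n_const]. Qed.

Lemma feval_liftA (h : R -> R) (a p : fnum) (n : nat) :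
  feval (liftA h) a p n = feval1 (fun A _ => h A) a p n.
Proof.
assert (Z : forall n, feval1 (fun _ _ => 0) a p n = 0).
{ intros k; apply sum_f_R0_zero; intros m _; apply sum_f_R0_zero; intros j _.
  unfold partial_derive.
  rewrite (Derive_n_ext _ (fun _ => 0)) by (intros; apply Derive_n_0).
  rewrite Derive_n_0; unfold Rdiv; ring. }
unfold feval; rewrite (sum_f_R0_trunc _ 0 n); [| lia |].
- simpl; rewrite Nat.sub_0_r; reflexivity.
- intros [|k] Hk; [lia | apply Z].
Qed.

Lemma feval_liftA_1 (h : R -> R) (a p : fnum) :
  feval (liftA h) a p 1%nat = Derive h (a O) * a 1%nat.
Proof.
rewrite feval_1.
change (dA (liftA h 0%nat) (a O) (p O)) with (Derive h (a O)).
rewrite (dphi_unique (liftA h 0%nat) (fun _ _ => 0)).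
- simpl; ring.
- intros; exact (is_derive_const (h x) y).
Qed.

Lemma feval_liftA_2 (h : R -> R) (a p : fnum) :
  feval (liftA h) a p 2%nat
  = Derive h (a O) * a 2%nat + Derive (Derive h) (a O) / 2 * a 1%nat ^ 2.
Proof.
rewrite feval_liftA.
assert (Z : forall m k x y, partial_derive m (S k) (fun A _ => h A) x y = 0).
{ intros m k x y; unfold partial_derive.
  rewrite (Derive_n_ext _ (fun _ => 0)) by (intros; apply Derive_n_const).
  apply Derive_n_0. }
unfold feval1; simpl sum_f_R0; rewrite !Z.
change (partial_derive 1 0 (fun A _ => h A) (a O) (p O)) with (Derive h (a O)).
change (partial_derive 2 0 (fun A _ => h A) (a O) (p O)) with (Derive (Derive h) (a O)).
unfold PS_mult; simpl; unfold PS_mult; simpl; unfold PS_mult; simpl; field.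
Qed.

(** Indices are lowered by one because [gen] multiplies by eps. *)
Definition epsgen (s1 s2 : R -> R -> R) : fseries :=
  fun k => match k with O => s1 | 1%nat => s2 | _ => fun _ _ => 0 end.

Lemma genfun_gen (h : R -> R) (s1 s2 : R -> R -> R) :
  genfun h s1 s2 = gen h (epsgen s1 s2).
Proof.
apply functional_extensionality; intros n; apply fun2_ext; intros x y.
change (gen h (epsgen s1 s2) n x y) with
  ((fconst x * fconst y + fconst (h x) + eps * at_pt (epsgen s1 s2) x y)%fnum n).
rewrite <- fconst_fmul, <- fconst_add.
destruct n as [|[|[|n]]]; unfold fadd; rewrite ?eps_mul_0, ?eps_mul_S;
  unfold at_pt; simpl; ring.
Qed.

Lemma smoothS_epsgen (s1 s2 : R -> R -> R) :
  smooth s1 -> smooth s2 -> smoothS (epsgen s1 s2).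
Proof. intros H1 H2 [|[|k]]; [exact H1 | exact H2 | exact (smooth_const 0)]. Qed.

Lemma perS_epsgen (s1 s2 : R -> R -> R) :
  (forall x y, s1 x (y + 2 * PI) = s1 x y) ->
  (forall x y, s2 x (y + 2 * PI) = s2 x y) -> perS (epsgen s1 s2).
Proof. intros H1 H2 [|[|k]]; [exact H1 | exact H2 | reflexivity]. Qed.

Lemma neg_eps_mul (a : fnum) (n : nat) : (neg_eps * a)%fnum n = - (eps * a)%fnum n.
Proof.
unfold neg_eps; replace (- eps * a)%fnum with (- (eps * a))%fnum by ring; reflexivity.
Qed.

Section LowOrder.

Context (H : R -> R) (V f c : R -> R -> R)
  (HH : smooth1 H) (HV : smooth V) (Hf : smooth f) (Hc : smooth c).

Let E := epsgen V f.
Let F := epsgen c (fun _ _ => 0).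

Lemma conj_gen_low (x y : R) :
  let w := y + Derive H x in
  conj_gen H E F O x y = x * y + H x /\
  conj_gen H E F 1%nat x y = V x y + c x w - c x y /\
  conj_gen H E F 2%nat x y
  = Derive (Derive H) x / 2 * dphi c x w ^ 2 + dA V x y * dphi c x w + f x y
    - dA c x y * (dphi c x w + dphi V x y - dphi c x y).
Proof.
intros w.
assert (SE : smoothS E) by (apply smoothS_epsgen; assumption).
assert (SF : smoothS F) by (apply smoothS_epsgen; [assumption | exact (smooth_const 0)]).
set (a := at_pt (mixed_field H E F A0_var) x y).
set (q := at_pt (mixed_field H E F phi_var) x y).
set (b := at_pt (mixed_field H E F A1_var) x y).
set (q' := at_pt (phi1_field H E F) x y).
assert (EX : at_pt (conj_gen H E F) x y
  = (b * q + feval (liftA H) b q + eps * feval E b q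
     + (fconst x * q' + eps * feval F (fconst x) q')
     + a * fconst y - b * q' - a * q - eps * feval F a q)%fnum).
{ unfold conj_gen.
  rewrite !at_addS, !at_mulS, !at_addS, !at_mulS, !at_cstS, !at_compS, !at_actS, !at_angS.
  fold a q b q'; rewrite !feval_gen by auto with smoothS.
  replace (liftA zero1) with (cstS (fconst 0)) by reflexivity.
  rewrite !feval_cstS; change (fconst 1) with PS_one; ring. }
assert (Eq : q = (fconst y + neg_eps * feval (fdA F) a q)%fnum).
{ unfold q at 1; rewrite mixed_field_eq; reflexivity. }
assert (Eb : b = (fconst x + eps * feval (fdphi F) (fconst x) q')%fnum).
{ unfold b at 1; rewrite mixed_field_eq; reflexivity. }
assert (Ea : a = (b + (eps * feval (fdphi E) b q + neg_eps * feval (fdphi F) a q))%fnum).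
{ unfold a at 1; rewrite mixed_field_eq, Eb at 1; reflexivity. }
assert (Eq' : q' = (q + feval (fdA (liftA H)) b q + eps * feval (fdA E) b q)%fnum).
{ unfold q' at 1, phi1_field; rewrite at_compS; apply feval_gen_A; auto with smoothS. }
assert (q0 : q O = y).
{ rewrite Eq; unfold fadd; rewrite neg_eps_mul, eps_mul_0; simpl; ring. }
assert (b0 : b O = x).
{ rewrite Eb; unfold fadd; rewrite eps_mul_0; simpl; ring. }
assert (a0 : a O = x).
{ rewrite Ea; unfold fadd; rewrite neg_eps_mul, !eps_mul_0, b0; ring. }
assert (q'0 : q' O = w).
{ rewrite Eq'; unfold fadd; rewrite eps_mul_0, feval_0, q0, b0.
  change (fdA (liftA H) 0%nat x y) with (Derive H x); unfold w; ring. }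
(* By criticality, the first-order parts of [q], [b] and [a] are all that is needed: their
   second-order parts and the positive-order part of [q'] cancel in the final [field]. *)
assert (q1 : q 1%nat = - dA c x y).
{ rewrite Eq; unfold fadd; rewrite neg_eps_mul, eps_mul_S, feval_0, a0, q0.
  simpl; change (fdA F 0%nat) with (dA c); ring. }
assert (b1 : b 1%nat = dphi c x w).
{ rewrite Eb; unfold fadd; rewrite eps_mul_S, feval_0, q'0.
  simpl; change (fdphi F 0%nat) with (dphi c); ring. }
assert (a1 : a 1%nat = dphi c x w + dphi V x y - dphi c x y).
{ rewrite Ea; unfold fadd; rewrite neg_eps_mul, !eps_mul_S, !feval_0, a0, b0, q0, b1.
  change (fdphi F 0%nat) with (dphi c); change (fdphi E 0%nat) with (dphi V); ring. }
assert (C : forall n, conj_gen H E F n x y = at_pt (conj_gen H E F) x y n) by reflexivity.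
rewrite !C, EX; clear C EX Eq Eb Ea Eq'.
unfold fadd, fsub.
rewrite !fmul_0, !fmul_1, !fmul_2, !feval_0, feval_liftA_1, feval_liftA_2, !feval_1.
simpl (eps _); simpl (fconst _ _).
rewrite a0, b0, q0, q'0, a1, b1, q1; unfold E, F; simpl.
change (liftA H 0%nat x y) with (H x).
unfold w; repeat split; field.
Qed.

End LowOrder.

(** * The control term *)

Lemma smooth_Derive1 (h : R -> R) : smooth1 h -> smooth1 (Derive h).
Proof. intros Hh; exact (smooth_dA _ Hh). Qed.

(** N V - Gamma V = (1 - e^{-{H}}) Gamma V - Gamma V = - e^{-{H}} Gamma V, and e^{-{H}} shifts the
    angle by - omega(A). *)
Lemma chi_shift (H : R -> R) (Gam : (R -> R -> R) -> R -> R -> R) (V : R -> R -> R) :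
  chi H Gam V = fun x y => - Gam V x (y - Derive H x).
Proof.
apply fun2_ext; intros x y; unfold chi, calN, calH, exp_bracket.
rewrite Derive_opp; unfold Rminus; ring.
Qed.

Section Control.

Context (H : R -> R) (V : R -> R -> R) (Gam : (R -> R -> R) -> R -> R -> R)
  (HH : smooth1 H) (HV : calA V) (HG : calA (Gam V)).

Lemma calA_chi : calA (chi H Gam V).
Proof.
destruct HG as [SG PG]; rewrite chi_shift; split.
- apply (smooth_ext (fun x y => 0 - Gam V x (y - Derive H x))); [|intros; ring].
  apply smooth_sub; [apply smooth_const|].
  apply (smooth_comp (Gam V) (fun x _ => x) (fun x y => y - Derive H x)).
  + exact SG.
  + exact smooth_fst.
  + apply smooth_sub; [exact smooth_snd | apply smooth_Derive1, HH].
- intros x y; rewrite <- (PG x (y - Derive H x)).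
  do 2 f_equal; ring.
Qed.

Lemma calR_chi (x y : R) :
  calR H Gam V x y = V x y - chi H Gam V x y - Gam V x y.
Proof. unfold calR, chi; ring. Qed.

Lemma calA_calR : calA (calR H Gam V).
Proof.
destruct HV as [SV PV], HG as [SG PG], calA_chi as [SC PC]; split.
- apply (smooth_ext _ _ (smooth_sub _ _ (smooth_sub _ _ SV SC) SG)).
  intros; symmetry; apply calR_chi.
- intros x y; rewrite !calR_chi, PV, PC, PG; reflexivity.
Qed.

Lemma calA_control_term : calA (control_term H Gam V).
Proof.
destruct HV as [SV PV], HG as [SG PG], calA_chi as [SC PC], calA_calR as [SR PR].
split.
- apply (smooth_add (fun x y => dA V x y * dphi (Gam V) x y
      - Derive (Derive H) x / 2 * dphi (Gam V) x y ^ 2)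
      (fun x y => dphi (calR H Gam V) x y * dA (chi H Gam V) x y)).
  + apply smooth_sub; [apply smooth_mul; [apply smooth_dA | apply smooth_dphi]; assumption|].
    apply smooth_mul.
    * apply (smooth_mul (fun x _ => Derive (Derive H) x)); [|apply smooth_const].
      apply smooth_Derive1, smooth_Derive1, HH.
    * apply (smooth_ext (fun x y => dphi (Gam V) x y * dphi (Gam V) x y));
        [|intros; ring].
      apply smooth_mul; apply smooth_dphi, SG.
  + apply smooth_mul; [apply smooth_dphi | apply smooth_dA]; assumption.
- intros x y; unfold control_term; cbv zeta.
  rewrite (dA_per V PV), (dphi_per (Gam V) SG PG), (dphi_per _ SR PR), (dA_per _ PC).
  reflexivity.
Qed.

Lemma conj_gen_controlled (k : nat) (x y : R) :
  (k < 3)%nat ->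
  conj_gen H (epsgen V (control_term H Gam V)) (epsgen (chi H Gam V) (fun _ _ => 0)) k x y
  = genfun H (calR H Gam V) (fun _ _ => 0) k x y.
Proof.
intros Hk.
destruct HV as [SV PV], HG as [SG PG], calA_chi as [SC PC],
  calA_control_term as [Sf Pf].
destruct (conj_gen_low H V (control_term H Gam V) (chi H Gam V) HH SV Sf SC x y)
  as (E0 & E1 & E2).
(* Evaluating chi at the rotated angle undoes its shift: chi(x, y + omega(x)) = - (Gamma V)(x,
   y). *)
assert (D : dphi (chi H Gam V) x (y + Derive H x) = - dphi (Gam V) x y).
{ rewrite chi_shift; apply is_derive_unique.
  apply (is_derive_opp (fun t => Gam V x (t - Derive H x))).
  evar_last.
  - apply (is_derive_comp (Gam V x) (fun t => t - Derive H x)).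
    + replace (y + Derive H x - Derive H x) with y by ring.
      apply smooth_is_dphi, SG.
    + auto_derive; [exact I | reflexivity].
  - exact (Rmult_1_l _). }
assert (DR : dphi (calR H Gam V) x y
             = dphi V x y - dphi (chi H Gam V) x y - dphi (Gam V) x y).
{ apply is_derive_unique.
  apply (is_derive_ext (fun t => V x t - chi H Gam V x t - Gam V x t)).
  - intros t; symmetry; apply calR_chi.
  - apply (is_derive_minus (fun t => V x t - chi H Gam V x t) (fun t => Gam V x t)).
    + apply (is_derive_minus (fun t => V x t) (fun t => chi H Gam V x t));
        apply smooth_is_dphi; assumption.
    + apply smooth_is_dphi; assumption. }
destruct k as [|[|[|k]]]; [exact E0 | | | lia].
- rewrite E1; simpl; rewrite calR_chi, !chi_shift.
  replace (y + Derive H x - Derive H x) with y by ring; ring.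
- rewrite E2, D; simpl; unfold control_term; cbv zeta; rewrite DR; ring.
Qed.

End Control.

Theorem mainTheorem2
    (H : R -> R) (V : R -> R -> R)
    (Gam : (R -> R -> R) -> (R -> R -> R))
    (hH : forall n A, ex_derive_n H n A)
    (hV : calA V)
    (hGam : pseudo_inverse H Gam) :
  exists S0 : fseries,
    eq_mod_eps3 S0 (genfun H (calR H Gam V) (fun _ _ => 0)) /\
    exists Tc T0 TX : fpoint -> fpoint,
      map_generated_by (S_c H Gam V) Tc /\
      map_generated_by S0 T0 /\
      map_generated_by (X_gen H Gam V) TX /\
      Bijective TX /\
      forall x : fpoint, T0 (TX x) = TX (Tc x).
Proof.
assert (HH : smooth1 H) by (apply smooth_1d, hH).
assert (HG : calA (Gam V)) by (apply hGam, hV).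
destruct (calA_chi H V Gam HH HG) as [SC PC].
destruct (calA_control_term H V Gam HH hV HG) as [Sf Pf].
set (E := epsgen V (control_term H Gam V)).
set (F := epsgen (chi H Gam V) (fun _ _ => 0)).
assert (SE : smoothS E) by (apply smoothS_epsgen; [apply hV | exact Sf]).
assert (PE : perS E) by (apply perS_epsgen; [apply hV | exact Pf]).
assert (SF : smoothS F) by (apply smoothS_epsgen; [exact SC | exact (smooth_const 0)]).
assert (PF : perS F) by (apply perS_epsgen; [exact PC | reflexivity]).
assert (EC : S_c H Gam V = gen H E) by apply genfun_gen.
assert (EX : X_gen H Gam V = gen zero1 F) by apply genfun_gen.
exists (conj_gen H E F); split.
- split.
  + intros k A phi Hk; apply conj_gen_controlled; assumption.
  (* All coefficients of order three and more form the remainder; having positive order, they are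
     periodic. *)
  + intros [|[|[|k]]] Hk; try lia; split.
    * apply smooth_sub; [apply smoothS_conj_gen; assumption | exact (smooth_const 0)].
    * intros A phi; rewrite conj_gen_per by assumption; reflexivity.
- set (Tc := gen_map H E); set (TX := gen_map zero1 F); set (IX := gen0_inv F).
  assert (LX : forall x, IX (TX x) = x) by (intros; apply gen0_inv_l, SF).
  assert (RX : forall x, TX (IX x) = x) by (intros; apply gen0_inv_r, SF).
  assert (GC : map_generated_by (gen H E) Tc) by (apply gen_map_generated; assumption).
  assert (GX : map_generated_by (gen zero1 F) TX)
    by (apply gen_map_generated; auto using smooth1_zero1).
  (* Conjugacy holds by construction; the substance is that this conjugate is the map generated by
     [conj_gen]. *)
  exists Tc, (fun x => TX (Tc (IX x))), TX.
  rewrite EC, EX.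
  destruct GC as [GC TC], GX as [GX TTX].
  split; [split; assumption|].
  split; [split|].
  + intros x x'; rewrite (conj_gen_generates H E F HH SE SF); split.
    * intros <-; exists (IX x), (Tc (IX x)).
      split; [apply GX, RX|]; split; [apply GC | apply GX]; reflexivity.
    * intros (w & w' & G1 & G2 & G3).
      apply GX in G1, G3; apply GC in G2; subst w' x x'.
      rewrite LX; reflexivity.
  (* The inverse [IX] commutes with full turns because [TX] does. *)
  + intros x; rewrite <- TTX, <- TC; do 2 f_equal.
    rewrite <- (RX x) at 1; rewrite <- TTX, LX; reflexivity.
  + split; [split; assumption|]; split.
    * exists IX; split; assumption.
    * intros x; rewrite LX; reflexivity.
Qed.
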